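(* Let $A,B,C,D:\mathfrak h^*\to \mathrm{End}(V\otimes V)$ be structure matrices satisfying, for all $h\in\mathfrak h$, the zero-weight conditions $$[h\otimes \mathbf 1,B_{12}]=0,\qquad [\mathbf 1\otimes h,C_{12}]=0,\qquad [h\otimes\mathbf 1+\mathbf 1\otimes h,D_{12}]=0,$$ the conditions $$B_{12}=C_{21},\qquad A_{21}=A_{12}^{-1},\qquad D_{21}=D_{12}^{-1},$$ and the dynamical Yang--Baxter type equations in $\mathrm{End}(V\otimes V\otimes V)$ $$A_{12}A_{13}A_{23}=A_{23}A_{13}A_{12},$$ $$D_{12}(\lambda+\gamma h_3)\,D_{13}\,D_{23}(\lambda+\gamma h_1)=D_{23}\,D_{13}(\lambda+\gamma h_2)\,D_{12},$$ $$D_{12}\,B_{13}\,B_{23}(\lambda+\gamma h_1)=B_{23}\,B_{13}(\lambda+\gamma h_2)\,D_{12},$$ $$A_{12}\,C_{13}\,C_{23}=C_{23}\,C_{13}\,A_{12}(\lambda+\gamma h_3),$$ where matrices without explicit argument are evaluated at $\lambda$. Then the exchange relations $$A_{12}(\lambda)\,T_1(\lambda)\,B_{12}(\lambda)\,T_2(\lambda+\gamma h_1)=T_2(\lambda)\,C_{12}(\lambda)\,T_1(\lambda+\gamma h_2)\,D_{12}(\lambda)$$ yield an associative dynamical quadratic algebra; that is, the 3-space exchange of $T$-matrices determined by these exchange relations is consistent with associativity.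
   Context: Setting. $\mathfrak h$ is the Cartan subalgebra of $\mathfrak{gl}(n)$, with basis $\{h_i\}_{i=1}^n$; $\lambda=(\lambda_1,\dots,\lambda_n)$ are the coordinates of $\lambda\in\mathfrak h^*$ in the dual basis; $\gamma$ is a complex parameter. $V$ is a finite-dimensional vector space which is a diagonalizable $\mathfrak h$-module, with a fixed basis $\{e_i\}$ of weight vectors, $e_i$ having weight $\mu_i\in\mathfrak h^*$. Transposition is taken with respect to this basis, so elements of $\mathfrak h$ act by diagonal (hence transposition-invariant) matrices. All functions of $\lambda$ are as regular as necessary. Labels. Indices $1,2,3,\dots$ (and $1',2',3',\dots$) label copies of $V$ on which matrices act; $X_{21}=X_{12}^{\pi}$ is obtained from $X_{12}$ by exchanging the two tensor factors; $X^{t_a}$ is partial transposition in space $a$. Dynamical shift. $f(\lambda+\gamma h_a)=\sum_{m\ge0}\frac{\gamma^m}{m!}\sum_{i_1,\dots,i_m}\frac{\partial^m f}{\partial\lambda_{i_1}\cdots\partial\lambda_{i_m}}\,h_{i_1}\cdots h_{i_m}$, where the $h_{i}$ act in the space labelled $a$; equivalently, it acts as $f(\lambda+\gamma\mu)$ on vectors whose component in space $a$ has weight $\mu$. Shifts in several spaces are defined analogously. Exchange algebra. $T(\lambda)=\sum_{i,j}T_{ij}(\lambda)E_{ij}$ is a matrix whose entries are the (noncommuting) generators of the algebra; $T_1=T\otimes\mathbf 1$, $T_2=\mathbf 1\otimes T$. View $T$ as the bivector $T_{\mathbf{11'}}(\lambda)=\sum_{i,j}T_{ij}(\lambda)\,e_i\otimes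 e_j\in V_1\otimes V_{1'}$, so that for example $T_{\mathbf{11'}}T_{\mathbf{22'}}(\lambda+\gamma h_{1'})=\sum T_{ij}(\lambda)T_{kl}(\lambda+\gamma\mu_j)\,e_i\otimes e_j\otimes e_k\otimes e_l$ in $V_1\otimes V_{1'}\otimes V_2\otimes V_{2'}$. Assuming the inverses below exist, the exchange relations are equivalent to $$\mathcal R_{11',22'}\,T_{\mathbf{11'}}T_{\mathbf{22'}}(\lambda+\gamma h_{1'})=T_{\mathbf{22'}}T_{\mathbf{11'}}(\lambda+\gamma h_{2'}),\qquad \mathcal R_{11',22'}=(C_{12'}^{t_{2'}})^{-1}(D_{1'2'}^{t_{1'}t_{2'}})^{-1}A_{12}B_{1'2}^{t_{1'}}.$$ Consistency of 3-space exchange. Using this relation (and its shifted versions) on adjacent factors, $T_{\mathbf{33'}}T_{\mathbf{22'}}(\lambda+\gamma h_{3'})T_{\mathbf{11'}}(\lambda+\gamma h_{2'}+\gamma h_{3'})$ can be rewritten as a matrix acting on $T_{\mathbf{11'}}T_{\mathbf{22'}}(\lambda+\gamma h_{1'})T_{\mathbf{33'}}(\lambda+\gamma h_{1'}+\gamma h_{2'})$ in two ways: exchanging first $3$ and $2$, then $3$ and $1$, then $2$ and $1$; or exchanging first $2$ and $1$, then $3$ and $1$, then $3$ and $2$. The 3-space exchange is consistent with associativity if these two ways give the same result, without imposing any further relations on the cubic monomials in the generators. This is the sense in which the exchange relations ''yield an associative dynamical quadratic algebra''. *)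

(* Defs.v *)
(* K below is to be the field R[i] of complex numbers, R : realType. *)
From HB Require Import structures.
From mathcomp Require Import all_boot all_order all_algebra.
From mathcomp Require Export complex reals.

Set Implicit Arguments.
Unset Strict Implicit.
Unset Printing Implicit Defensive.
Import GRing.Theory.
Local Open Scope ring_scope.

Definition s1 {k : nat} : 'I_k.+1 := ord0.
Definition s2 {k : nat} : 'I_k.+2 := @Ordinal k.+2 1 isT.
Definition s3 {k : nat} : 'I_k.+3 := @Ordinal k.+3 2 isT.

(* For a finite set L of labels, one copy of V = K^N per label: the basis
   vectors of the tensor product are the functions L -> 'I_N. *)
Notation tidx L N := {ffun L -> 'I_N}.
Notation op S N L := 'M[S]_#|tidx L N|.
Notation tvec S N L := 'cV[S]_#|tidx L N|.

Definition mkop (S : Type) (N : nat) (L : finType)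
    (f : tidx L N -> tidx L N -> S) : op S N L :=
  \matrix_(i, j) f (enum_val i) (enum_val j).

Definition entry (S : Type) (N : nat) (L : finType) (X : op S N L)
    (s t : tidx L N) : S := X (enum_rank s) (enum_rank t).

(* X^pi, i.e. X_21. *)
Definition flip (S : Type) (N : nat) (X : op S N 'I_2) : op S N 'I_2 :=
  mkop (fun s t => entry X [ffun i => s (rev_ord i)] [ffun i => t (rev_ord i)]).

(* Transposition in the spaces whose labels satisfy P. *)
Definition ptr (S : Type) (N : nat) (L : finType) (P : pred L)
    (X : op S N L) : op S N L :=
  mkop (fun s t => entry X [ffun l => if P l then t l else s l]
                           [ffun l => if P l then s l else t l]).

Section Dynamical.
Context {K : fieldType} {n N : nat}.
Variables (gamma : K) (mu : 'I_N -> 'rV[K]_n).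

(* The element h = \sum_i x_i h_i of the Cartan subalgebra acting in space a. *)
Definition hact {L : finType} (x : 'rV[K]_n) (a : L) : op K N L :=
  diag_mx (\row_i \sum_(j < n) x 0 j * mu ((enum_val i : tidx L N) a) 0 j).

(* The value of lambda + gamma \sum_(c in P) h_c on the basis vector t. *)
Definition dyn {L : finType} (lam : 'rV[K]_n) (P : seq L) (t : tidx L N) :
  'rV[K]_n := lam + gamma *: \sum_(c <- P) mu (t c).

(* X(lambda + gamma \sum_(c in P) h_c) acting in the spaces f j, j : J, where f
   is injective and no label f j belongs to P. *)
Definition emb {J L : finType} (f : J -> L) (X : 'rV[K]_n -> op K N J)
    (lam : 'rV[K]_n) (P : seq L) : op K N L :=
  mkop (fun s t => if [forall l, (l \notin codom f) ==> (s l == t l)]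
                   then entry (X (dyn lam P t)) [ffun j => s (f j)]
                                                [ffun j => t (f j)]
                   else 0).

(* X_ab(lambda + gamma \sum_(c in P) h_c). *)
Definition leg2 {L : finType} (X : 'rV[K]_n -> op K N 'I_2)
    (lam : 'rV[K]_n) (P : seq L) (a b : L) : op K N L :=
  emb (fun i : 'I_2 => if i == s1 then a else b) X lam P.

Section Exchange.
Variables A B C D : 'rV[K]_n -> op K N 'I_2.

Section Generators.
Variables (alg : algType K) (T : 'rV[K]_n -> 'M[alg]_N).

Definition scal {p q : nat} (M : 'M[K]_(p, q)) : 'M[alg]_(p, q) :=
  map_mx (GRing.in_alg alg) M.

(* T_a(lambda + gamma \sum_(c in P) h_c). *)
Definition leg1 {L : finType} (lam : 'rV[K]_n) (P : seq L) (a : L) :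
  op alg N L :=
  mkop (fun s t => if [forall l, (l != a) ==> (s l == t l)]
                   then T (dyn lam P t) (s a) (t a) else 0).

Definition exchange_relations : Prop := forall lam : 'rV[K]_n,
  scal (A lam) *m leg1 lam [::] s1 *m scal (B lam) *m leg1 lam [:: s1] s2 =
  leg1 lam [::] s2 *m scal (C lam) *m leg1 lam [:: s2] s1 *m scal (D lam).

(* In what follows the label (p, false) is p and the label (p, true) is p'. *)
Fixpoint Tword {k : nat} (s : tidx ('I_k * bool)%type N) (lam : 'rV[K]_n)
    (ps : seq 'I_k) : alg :=
  if ps is p :: qs then
    T lam (s (p, false)) (s (p, true))
      * Tword s (lam + gamma *: mu (s (p, true))) qs
  else 1.

(* For ps = [:: p; q; r], this is
   T_pp'(lambda) T_qq'(lambda + gamma h_p') T_rr'(lambda + gamma (h_p' + h_q')),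
   a vector with entries in alg. *)
Definition Tprod {k : nat} (lam : 'rV[K]_n) (ps : seq 'I_k) :
  tvec alg N ('I_k * bool)%type :=
  \col_i Tword (enum_val i) lam ps.

End Generators.

Definition calR (lam : 'rV[K]_n) : op K N ('I_2 * bool)%type :=
  leg2 (fun l => invmx (ptr (pred1 s2) (C l))) lam [::] (s1, false) (s2, true)
  *m leg2 (fun l => invmx (ptr predT (D l))) lam [::] (s1, true) (s2, true)
  *m leg2 A lam [::] (s1, false) (s2, false)
  *m leg2 (fun l => ptr (pred1 s1) (B l)) lam [::] (s1, true) (s2, false).

(* calR_{pp',qq'}(lambda + gamma \sum_(c in P) h_c). *)
Definition calR_at {k : nat} (lam : 'rV[K]_n) (P : seq ('I_k * bool)%type)
    (p q : 'I_k) : op K N ('I_k * bool)%type :=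
  emb (fun u : ('I_2 * bool)%type => (if u.1 == s1 then p else q, u.2))
    calR lam P.

(* A triple-product expression M * Tprod lam [:: p; q; r] is represented
   by the pair (M, (p, q, r)). *)
Definition cubic : Type :=
  (op K N ('I_3 * bool)%type * ('I_3 * 'I_3 * 'I_3))%type.

Definition order_of (u : cubic) : seq 'I_3 :=
  let: (_, (p, q, r)) := u in [:: p; q; r].

(* T_pp' T_qq'(lambda + gamma h_p') is replaced by
   calR_{qq',pp'} T_qq' T_pp'(lambda + gamma h_q'). *)
Definition exch_left (lam : 'rV[K]_n) (u : cubic) : cubic :=
  let: (M, (p, q, r)) := u in (M *m calR_at lam [::] q p, (q, p, r)).

(* The same for the last two factors, with lambda shifted by gamma h_p'. *)
Definition exch_right (lam : 'rV[K]_n) (u : cubic) : cubic :=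
  let: (M, (p, q, r)) := u in
  (M *m calR_at lam [:: (p, true)] r q, (p, r, q)).

Definition cubic_start : cubic := (1%:M, (s3, s2, s1)).

(* Exchange 3 and 2, then 3 and 1, then 2 and 1. *)
Definition exchange_32_31_21 (lam : 'rV[K]_n) : cubic :=
  exch_left lam (exch_right lam (exch_left lam cubic_start)).

(* Exchange 2 and 1, then 3 and 1, then 3 and 2. *)
Definition exchange_21_31_32 (lam : 'rV[K]_n) : cubic :=
  exch_right lam (exch_left lam (exch_right lam cubic_start)).

(* [relations_equiv] and [rewriting_sound] tie the rewriting steps to
   the exchange relations; [three_space_consistent] compares the two resulting
   coefficient matrices themselves, the cubic monomials being unconstrained. *)
Definition relations_equiv : Prop :=
  forall (alg : algType K) (T : 'rV[K]_n -> 'M[alg]_N),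
    exchange_relations T <->
    (forall lam, scal alg (calR lam) *m Tprod T lam [:: s1; s2]
                 = Tprod T lam [:: s2; s1]).

Definition rewriting_sound : Prop :=
  forall (alg : algType K) (T : 'rV[K]_n -> 'M[alg]_N),
    exchange_relations T -> forall (lam : 'rV[K]_n) (u : cubic),
    uniq (order_of u) ->
    let value (w : cubic) := scal alg w.1 *m Tprod T lam (order_of w) in
    value (exch_left lam u) = value u /\ value (exch_right lam u) = value u.

Definition three_space_consistent : Prop :=
  forall lam : 'rV[K]_n, exchange_32_31_21 lam = exchange_21_31_32 lam.

End Exchange.
End Dynamical.

(* Main.v *)
(* Write c, d for the inverses of C^t (transposed in its second space) and
   D^{tt}, and t for C^t, so that R_{11',22'} = c_{12'} d_{1'2'} A_{12} t_{21'},
   because B_{12} = C_{21} gives B_{1'2}^{t_{1'}} = t_{21'}.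
   Transposing D C C = C C D in the spaces of D and A C C = C C A in the space
   not seen by A (a partial transposition reverses the order in the transposed
   spaces only, and the zero-weight conditions absorb the dynamical shifts)
   yields relations between c, d, A and t; together with the Yang-Baxter
   equations of A and D they turn the word of length 12 of
   R_{23} R_{13}(h_{2'}) R_{12} into that of R_{12}(h_{3'}) R_{13} R_{23}(h_{1'}),
   which is the consistency of the two cubic exchanges. *)
Require Import Defs.
From mathcomp Require Import all_boot all_order all_fingroup all_algebra.
From mathcomp Require Import complex reals.
Set Implicit Arguments.
Unset Strict Implicit.
Unset Printing Implicit Defensive.
Import GRing.Theory.
Local Open Scope ring_scope.

(** * Operators on tensor products in coordinates *)

Section Entries.
Context {N : nat}.

(** The two twelve-letter words are linked through a sorted one, in which the letters stand in the
    blocks c c c d d d a a a t t t. There the Yang-Baxter equations of d and a apply; the remaining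
    relations, each used once, sort the left word and break the sorted one up again. The obstacle is
    the dynamical shift: letters in disjoint spaces need not commute when one is shifted by a weight
    that the other may change. Hence [conserves] records which weights an operator preserves, and
    every commutation or transposition rule asks for this exactly at the spaces that occur in
    shifts. D preserves only the total weight of its two spaces, so the words are arranged such that
    d never passes a letter shifted by one of its own spaces. *)

Lemma entry_mkop (S : Type) (L : finType) (f : tidx L N -> tidx L N -> S) s t :
  entry (mkop f) s t = f s t.
Proof. by rewrite /entry mxE !enum_rankK. Qed.

Lemma opP (S : Type) (L : finType) (X Y : op S N L) :
  (forall s t, entry X s t = entry Y s t) -> X = Y.
Proof.
move=> eqXY; apply/matrixP => i j.
by rewrite -(enum_valK i) -(enum_valK j); apply: eqXY.
Qed.

Lemma sum_enum_rank (V : nmodType) (T : finType) (F : 'I_#|T| -> V) :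
  \sum_i F i = \sum_(x : T) F (enum_rank x).
Proof. by rewrite (reindex (@enum_rank T)) //; apply: onW_bij (enum_rank_bij T). Qed.

Lemma entry_mul (S : pzRingType) (L : finType) (X Y : op S N L) s t :
  entry (X *m Y) s t = \sum_u entry X s u * entry Y u t.
Proof. by rewrite /entry mxE sum_enum_rank. Qed.

Lemma entry1 (S : pzRingType) (L : finType) (s t : tidx L N) :
  entry (1%:M : op S N L) s t = (s == t)%:R.
Proof. by rewrite /entry mxE (inj_eq enum_rank_inj). Qed.

Lemma entry_tr (S : Type) (L : finType) (X : op S N L) s t :
  entry X^T s t = entry X t s.
Proof. by rewrite /entry mxE. Qed.

End Entries.

(** * Splicing basis vectors along a map of label sets *)

Section Insertion.
Context {N : nat} {J L : finType}.
Variable f : J -> L.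
Implicit Types (s t : tidx L N) (v : tidx J N).

Definition restr s : tidx J N := [ffun j => s (f j)].

Definition insert s v : tidx L N :=
  [ffun l => if [pick j | f j == l] is Some j then v j else s l].

Definition agree_off s t : bool := [forall l, (l \notin codom f) ==> (s l == t l)].

Lemma agree_offP s t :
  reflect (forall l, l \notin codom f -> s l = t l) (agree_off s t).
Proof.
apply: (iffP forallP) => [H l lf|H l]; first by have /implyP/(_ lf)/eqP := H l.
by apply/implyP => lf; rewrite H.
Qed.

Lemma insert_out s v l : l \notin codom f -> insert s v l = s l.
Proof.
move=> lf; rewrite ffunE; case: pickP => // j /eqP fj.
by rewrite -fj codom_f in lf.
Qed.

Hypothesis f_inj : injective f.

Lemma insert_in s v j : insert s v (f j) = v j.
Proof.
rewrite ffunE; case: pickP => [k /eqP/f_inj -> //|/(_ j)].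
by rewrite eqxx.
Qed.

Lemma restr_insert s v : restr (insert s v) = v.
Proof. by apply/ffunP => j; rewrite ffunE insert_in. Qed.

(** Once the spectator spaces are fixed by s, one free index per label of J remains, and [restr]
    recovers it from [insert s]. *)
Lemma sum_agree_off (V : nmodType) (G : tidx L N -> V) s :
  \sum_(t | agree_off s t) G t = \sum_v G (insert s v).
Proof.
rewrite (reindex_onto (insert s) restr) /=.
  apply: eq_bigl => v; rewrite restr_insert eqxx andbT.
  by apply/agree_offP => l lf; rewrite insert_out.
move=> t /agree_offP st; apply/ffunP => l.
have [/codomP[j ->]|lf] := boolP (l \in codom f).
  by rewrite insert_in ffunE.
by rewrite insert_out // st.
Qed.

End Insertion.

(** * The two words of the cubic exchange *)

Section Words.
Context {L : eqType}.
Implicit Types (Z : pred 'I_2) (a b c d : L).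

(* A two-space operator in the spaces a and b which commutes with the Cartan
   action on the factors in Z commutes with the Cartan action in the space c. *)
Definition kept Z a b c : bool := ((c == a) ==> Z s1) && ((c == b) ==> Z s2).

Definition exchangeable (R : pzRingType) Z Z' (F G : seq L -> L -> L -> R) : Prop :=
  forall P Q a b c d, uniq [:: a; b; c; d] ->
    all (kept Z a b) Q -> all (kept Z' c d) P ->
    F P a b * G Q c d = G Q c d * F P a b.

End Words.

Local Notation space := ('I_3 * bool)%type.

(* In all commutations each shift of one operator is by the weight of a space in
   which the other one either acts trivially or preserves weights. *)
Lemma yang_baxter_words (R : pzRingType) (a c d t : seq space -> space -> space -> R) :
  let Za := pred0 in let Zd := pred0 in let Zc := pred1 s2 in let Zt := pred1 s2 in
  exchangeable Zt Zc t c -> exchangeable Za Zc a c -> exchangeable Zt Zd t d ->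
  exchangeable Za Zd a d -> exchangeable Zd Zc d c -> exchangeable Zt Za t a ->
  exchangeable Zt Zt t t -> exchangeable Zc Zc c c ->
  (forall x y z, uniq [:: x; y; z] ->
    [/\ a [::] x y * a [::] x z * a [::] y z = a [::] y z * a [::] x z * a [::] x y,
        d [:: z] x y * d [::] x z * d [:: x] y z = d [::] y z * d [:: y] x z * d [::] x y,
        a [::] x y * t [::] y z * t [::] x z = t [::] x z * t [::] y z * a [:: z] x y,
        c [::] y z * c [::] x z * a [::] x y = a [:: z] x y * c [::] x z * c [::] y z
      & t [::] y z * a [:: z] x y * c [::] x z = c [::] x z * a [::] x y * t [::] y z]) ->
  (forall x y z, uniq [:: x; y; z] ->
    [/\ d [::] x y * c [:: x] z y * c [::] z x = c [:: y] z x * c [::] z y * d [::] x y,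
        t [::] z y * t [:: y] z x * d [::] x y = d [::] x y * t [::] z x * t [:: x] z y
      & c [::] z y * d [::] x y * t [::] z x = t [:: y] z x * d [::] x y * c [:: x] z y]) ->
  let r P p q := c P (p, false) (q, true) * d P (p, true) (q, true)
    * a P (p, false) (q, false) * t P (q, false) (p, true) in
  r [::] s2 s3 * r [:: (s2, true)] s1 s3 * r [::] s1 s2 =
  r [:: (s3, true)] s1 s2 * r [::] s1 s3 * r [:: (s1, true)] s2 s3.
Proof.
move=> Za Zd Zc Zt TC AC TD AD DC TA TT CC relA relD r.
(* The tail W lets each commutation act anywhere inside a right-nested product; [sw'] is the same
   rule used in the opposite direction. *)
have sw Z Z' (F G : seq space -> space -> space -> R) :
    exchangeable Z Z' F G -> forall P Q x y z w W,
    uniq [:: x; y; z; w] -> all (kept Z x y) Q -> all (kept Z' z w) P ->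
    F P x y * (G Q z w * W) = G Q z w * (F P x y * W) :> R.
  by move=> E P Q x y z w W u kQ kP; rewrite !mulrA E.
have sw' Z Z' (F G : seq space -> space -> space -> R) :
    exchangeable Z Z' F G -> forall P Q x y z w W,
    uniq [:: z; w; x; y] -> all (kept Z z w) P -> all (kept Z' x y) Q ->
    G P x y * (F Q z w * W) = F Q z w * (G P x y * W) :> R.
  by move=> E P Q x y z w W u kQ kP; rewrite (sw _ _ _ _ E).
have mul3W X Y T X' Y' T' : X * Y * T = X' * Y' * T' ->
    forall W, X * (Y * (T * W)) = X' * (Y' * (T' * W)) :> R.
  by move=> E W; rewrite !mulrA E.
have sTC := sw _ _ _ _ TC.
have sAC := sw _ _ _ _ AC.
have sTD := sw _ _ _ _ TD.
have sAD := sw _ _ _ _ AD.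
have sDC := sw _ _ _ _ DC.
have sTA := sw _ _ _ _ TA.
have sTT := sw _ _ _ _ TT.
have sCC := sw _ _ _ _ CC.
have sDA := sw' _ _ _ _ AD.
have sCD := sw' _ _ _ _ DC.
have sAT := sw' _ _ _ _ TA.
have sDT := sw' _ _ _ _ TD.
have sCT := sw' _ _ _ _ TC.
have rAAA x y z (u : uniq [:: x; y; z]) := mul3W _ _ _ _ _ _
  (let: And5 E _ _ _ _ := relA x y z u in E).
have rDDD x y z (u : uniq [:: x; y; z]) := mul3W _ _ _ _ _ _
  (let: And5 _ E _ _ _ := relA x y z u in E).
have rATT x y z (u : uniq [:: x; y; z]) := mul3W _ _ _ _ _ _
  (let: And5 _ _ E _ _ := relA x y z u in E).
have rCCA x y z (u : uniq [:: x; y; z]) := mul3W _ _ _ _ _ _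
  (let: And5 _ _ _ E _ := relA x y z u in E).
have rTAC x y z (u : uniq [:: x; y; z]) := mul3W _ _ _ _ _ _
  (let: And5 _ _ _ _ E := relA x y z u in E).
have rDCC x y z (u : uniq [:: x; y; z]) := mul3W _ _ _ _ _ _
  (let: And3 E _ _ := relD x y z u in E).
have rTTD x y z (u : uniq [:: x; y; z]) := mul3W _ _ _ _ _ _
  (let: And3 _ E _ := relD x y z u in E).
have rCDT x y z (u : uniq [:: x; y; z]) := mul3W _ _ _ _ _ _
  (let: And3 _ _ E := relD x y z u in E).
(* The extra factor 1 supplies the last letter with a tail. *)
rewrite /r -[LHS]mulr1 -[RHS]mulr1 -!mulrA.
(* In the right word only c and d of the last operator move, to the left of a and t of the middle
   one. All further rewriting concerns the left word. *)
rewrite [in RHS](sTC _ _ (s3, false)) //.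
rewrite [in RHS]sAC // [in RHS]sTD //.
rewrite [in RHS]sAD //.
rewrite sTC // sAC //.
rewrite sTD // sAD // sTC //.
(* The letters t_{32'}, a_{13}(h_{2'}) and c_{12'} overlap pairwise and cannot be commuted one by
   one; where letters overlap, the cubic relations t a c, d c c and t t d do the sorting. *)
rewrite (rTAC _ _ _ (isT : uniq [:: (s1, false); (s3, false); (s2, true)])).
rewrite sAC // (sDC _ _ (s1, true)) //.
rewrite (rDCC _ _ _ (isT : uniq [:: (s2, true); (s3, true); (s1, false)])).
rewrite (rTTD _ _ _ (isT : uniq [:: (s1, true); (s2, true); (s3, false)])).
rewrite sAD // sAD //.
rewrite sTA // sTA //.
(* The word is now sorted into c c c d d d a a a t t t. *)
rewrite -(rDDD _ _ _ (isT : uniq [:: (s1, true); (s2, true); (s3, true)])).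
rewrite -(rAAA _ _ _ (isT : uniq [:: (s1, false); (s2, false); (s3, false)])).
(* The blocks are broken up again: a t t, c c a and c d t put on a, t and c the shifts by 1' and 3'
   which they carry in the right word. *)
rewrite (sTT _ _ _ (s2, true)) // sCC //.
rewrite (rATT _ _ _ (isT : uniq [:: (s2, false); (s3, false); (s1, true)])).
rewrite sDA // sDA // sDA //.
rewrite (rCCA _ _ _ (isT : uniq [:: (s1, false); (s2, false); (s3, true)])).
rewrite sCD // sCD // sAD //.
rewrite sAT // sDT //.
rewrite (rCDT _ _ _ (isT : uniq [:: (s1, true); (s3, true); (s2, false)])).
by rewrite sCT.
Qed.

(** * Embedded operators, weights and partial transposition *)

Section Dynamical.
Context {K : fieldType} {n N : nat}.
Variables (gamma : K) (mu : 'I_N -> 'rV[K]_n).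
Notation emb := (emb gamma mu).
Notation dyn := (dyn gamma mu).
Notation leg2 := (leg2 gamma mu).

Lemma entry_emb (J L : finType) (f : J -> L) X lam P s t :
  entry (emb f X lam P) s t =
  if agree_off f s t then entry (X (dyn lam P t)) (restr f s) (restr f t) else 0.
Proof. by rewrite entry_mkop. Qed.

Lemma eq_emb (J L : finType) (f g : J -> L) X Y lam P :
  f =1 g -> X =1 Y -> emb f X lam P = emb g Y lam P.
Proof.
move=> fg XY; apply: opP => s t; rewrite !entry_emb XY.
have -> : agree_off f s t = agree_off g s t.
  by apply: eq_forallb => l; rewrite (eq_codom fg).
have e u : restr f u = restr g u by apply/ffunP => j; rewrite !ffunE fg.
by rewrite !e.
Qed.

Lemma eq_dyn (L : finType) lam P (s t : tidx L N) :
  {in P, forall c, mu (s c) = mu (t c)} -> dyn lam P s = dyn lam P t.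
Proof. by move=> st; rewrite /dyn /Defs.dyn (eq_big_seq _ st). Qed.

(** The shift is read off the column index t, but P avoids the spaces in which X acts, so at nonzero
    entries it can be read off the row index s and does not vary with t. The arbitrary [G] serves
    both products of operators and actions on vectors with entries in the algebra. *)
Lemma emb_sum (J L : finType) (f : J -> L) X lam P s (V : nmodType)
    (G : K -> tidx L N -> V) :
  injective f -> {in P, forall c, c \notin codom f} -> (forall t, G 0 t = 0) ->
  \sum_t G (entry (emb f X lam P) s t) t =
  \sum_v G (entry (X (dyn lam P s)) (restr f s) v) (insert f s v).
Proof.
move=> f_inj Pf G0.
transitivity (\sum_(t | agree_off f s t)
    G (entry (X (dyn lam P s)) (restr f s) (restr f t)) t); last first.
  by rewrite sum_agree_off //; apply: eq_bigr => v _; rewrite restr_insert.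
rewrite [RHS]big_mkcond; apply: eq_bigr => t _; rewrite entry_emb.
case: ifP => // /agree_offP st; congr (G (entry (X _) _ _) t).
by apply: eq_dyn => c cP; rewrite st ?Pf.
Qed.

Lemma emb_mul (J L : finType) (f : J -> L) X Y lam P :
  injective f -> {in P, forall c, c \notin codom f} ->
  emb f (fun l => X l *m Y l) lam P = emb f X lam P *m emb f Y lam P.
Proof.
move=> f_inj Pf; apply: opP => s t; rewrite entry_mul.
rewrite (@emb_sum _ _ f X lam P s _
  (fun (x : K) (u : tidx L N) => x * entry (emb f Y lam P) u t)) //; last first.
  by move=> u; rewrite mul0r.
rewrite entry_emb; case: agree_offP => [st|nst]; last first.
  rewrite big1 // => v _; rewrite entry_emb; case: agree_offP => [st|]; last first.
    by rewrite mulr0.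
  by case: nst => l lf; rewrite -(st l lf) insert_out.
rewrite entry_mul; apply: eq_bigr => v _; rewrite entry_emb restr_insert //.
case: agree_offP => [_|[l lf]]; last by rewrite insert_out // st.
by congr (entry (X _) _ _ * _); apply: eq_dyn => c cP; rewrite st ?Pf.
Qed.

Lemma emb1 (J L : finType) (f : J -> L) lam P : emb f (fun=> 1%:M) lam P = 1%:M.
Proof.
apply: opP => s t; rewrite entry_emb !entry1.
case: agree_offP => [st|nst]; last first.
  by case: eqP => // st; case: nst => l _; rewrite st.
congr (nat_of_bool _)%:R; apply/eqP/eqP => [rst|-> //]; apply/ffunP => l.
have [/codomP[j ->]|/st//] := boolP (l \in codom f).
by have := congr1 (fun v : tidx _ _ => v j) rst; rewrite !ffunE.
Qed.

(** This carries relations proved on a few labels, together with their shifts, to the six spaces of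
    the cubic exchange. *)
Lemma emb_emb (I J L : finType) (f : I -> J) (g : J -> L) X lam P Q :
  injective g ->
  emb g (fun l => emb f X l P) lam Q = emb (g \o f) X lam (map g P ++ Q).
Proof.
move=> g_inj; apply: opP => s t; rewrite !entry_emb.
have rr u : restr f (restr g u) = restr (g \o f) u.
  by apply/ffunP => i; rewrite !ffunE.
have -> : dyn (dyn lam Q t) P (restr g t) = dyn lam (map g P ++ Q) t.
  rewrite /dyn /Defs.dyn big_cat big_map scalerDr [X in _ = _ + X]addrC addrA.
  by congr (_ + _ *: _); apply: eq_bigr => c _; rewrite ffunE.
have cgf i : (g i \in codom (g \o f)) = (i \in codom f).
  apply/codomP/codomP => [[j /g_inj->]|[j ->]]; by exists j.
rewrite !rr; case: (agree_offP g) => [st|nst].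
  congr (if _ then _ else _); apply/agree_offP/agree_offP => H l.
    have [/codomP[j ->]|/st//] := boolP (l \in codom g).
    by rewrite cgf => /H; rewrite !ffunE.
  by rewrite -cgf => /H; rewrite !ffunE.
case: agree_offP => // H; case: nst => l lg; apply: H.
by apply: contra lg => /codomP[j ->]; apply: codom_f.
Qed.

(** * Conserved weights *)

Definition conserves (L : finType) (W : seq L) (X : op K N L) : Prop :=
  forall s t, entry X s t != 0 ->
    \sum_(c <- W) mu (s c) = \sum_(c <- W) mu (t c).

Lemma conserves1P (L : finType) (c : L) (X : op K N L) s t :
  conserves [:: c] X -> entry X s t != 0 -> mu (s c) = mu (t c).
Proof. by move=> /[apply]; rewrite !big_seq1. Qed.

Lemma conserves_mul (L : finType) (W : seq L) (X Y : op K N L) :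
  conserves W X -> conserves W Y -> conserves W (X *m Y).
Proof.
move=> cX cY s t; rewrite entry_mul => XY0.
have [u] : exists u, entry X s u * entry Y u t != 0.
  apply/existsP; apply: contraNT XY0 => /existsPn H.
  by rewrite big1 // => u _; have /negPn/eqP := H u.
by rewrite mulf_eq0 negb_or => /andP[/cX-> /cY].
Qed.

Lemma conserves_cons (L : finType) (W : seq L) c (X : op K N L) :
  conserves [:: c] X -> conserves W X -> conserves (c :: W) X.
Proof.
by move=> cX cW s t X0; rewrite !big_cons (conserves1P cX X0) (cW _ _ X0).
Qed.

(** The entry (s, t) of the commutator with the j-th diagonal matrix is that of X times the j-th
    coordinate of the difference of the weights of t and s; over a field a nonzero entry forces this
    difference to vanish. *)
Lemma conserves_comm (L : finType) (W : seq L) (X : op K N L) :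
  conserves W X <->
  forall j, comm_mx X (diag_mx (\row_i (\sum_(c <- W) mu ((enum_val i : tidx L N) c)) 0 j)).
Proof.
have E j s t : entry (X *m diag_mx
    (\row_i (\sum_(c <- W) mu ((enum_val i : tidx L N) c)) 0 j)) s t
   = entry X s t * (\sum_(c <- W) mu (t c)) 0 j.
  rewrite /entry mul_mx_diag !mxE; congr (_ * _).
  by rewrite enum_rankK.
have E' j s t : entry (diag_mx
    (\row_i (\sum_(c <- W) mu ((enum_val i : tidx L N) c)) 0 j) *m X) s t
   = (\sum_(c <- W) mu (s c)) 0 j * entry X s t.
  rewrite /entry mul_diag_mx !mxE; congr (_ * _).
  by rewrite enum_rankK.
split=> [cX j|cX s t X0].
  apply: opP => s t; rewrite E E' mulrC.
  by have [->|/cX->//] := eqVneq (entry X s t) 0; rewrite !mulr0.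
apply/rowP => j; have := congr1 (fun Z => entry Z s t) (cX j).
by rewrite /= E E' mulrC => /(mulIf X0).
Qed.

Lemma conserves_inv (L : finType) (W : seq L) (X : op K N L) :
  X \in unitmx -> conserves W X -> conserves W (invmx X).
Proof.
move=> Xu /conserves_comm cX; apply/conserves_comm => j.
set H := diag_mx _; rewrite /comm_mx -{1}(mulmxK Xu H).
by rewrite -(cX j : X *m H = _) -!mulmxA mulKmx.
Qed.

(** In the space c a partial transposition either keeps or exchanges the two indices, and equality
    of weights is symmetric. *)
Lemma conserves_ptr (L : finType) c (P : pred L) (X : op K N L) :
  conserves [:: c] X -> conserves [:: c] (ptr P X).
Proof.
move=> cX s t; rewrite entry_mkop !big_seq1 => /(conserves1P cX).
by rewrite !ffunE; case: ifP.
Qed.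

Lemma conserves_emb (J L : finType) (f : J -> L) X lam P j :
  injective f -> (forall l, conserves [:: j] (X l)) ->
  conserves [:: f j] (emb f X lam P).
Proof.
move=> f_inj cX s t; rewrite entry_emb !big_seq1; case: ifP => [_|]; last first.
  by rewrite eqxx.
by move=> /(conserves1P (cX _)); rewrite !ffunE.
Qed.

Lemma conserves_out (J L : finType) (f : J -> L) X lam P c :
  c \notin codom f -> conserves [:: c] (emb f X lam P).
Proof.
move=> cf s t; rewrite entry_emb !big_seq1; case: agree_offP => [->//|].
by rewrite eqxx.
Qed.

(** * Partial transposition and its effect on products *)

Lemma ptr_emb (J L : finType) (f : J -> L) X lam P (T : pred L) :
  {in P, forall c, c \notin codom f} ->
  ptr T (emb f X lam P) = emb f (fun l => ptr (T \o f) (X l)) lam P.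
Proof.
move=> Pf; apply: opP => s t; rewrite entry_mkop !entry_emb entry_mkop.
have -> : agree_off f [ffun l => if T l then t l else s l]
   [ffun l => if T l then s l else t l] = agree_off f s t.
  apply: eq_forallb => l; rewrite !ffunE; case: (T l) => //.
  by rewrite eq_sym.
case: agree_offP => // st; congr (entry (X _) _ _).
- by apply: eq_dyn => c cP; rewrite ffunE -st ?Pf // if_same.
- by apply/ffunP => j; rewrite !ffunE.
- by apply/ffunP => j; rewrite !ffunE.
Qed.

Lemma eq_ptr (S : Type) (L : finType) (P Q : pred L) (X : op S N L) :
  P =1 Q -> ptr P X = ptr Q X.
Proof.
move=> PQ; apply: opP => s t; rewrite !entry_mkop.
by congr entry; apply/ffunP => l; rewrite !ffunE PQ.
Qed.

Lemma ptr_pred0 (S : Type) (L : finType) (X : op S N L) : ptr pred0 X = X.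
Proof.
apply: opP => s t; rewrite !entry_mkop.
by congr entry; apply/ffunP => l; rewrite !ffunE.
Qed.

Lemma ptr_predT (S : Type) (L : finType) (X : op S N L) : ptr predT X = X^T.
Proof.
apply: opP => s t; rewrite !entry_mkop entry_tr.
by congr entry; apply/ffunP => l; rewrite !ffunE.
Qed.

Lemma ptr_predC (S : Type) (L : finType) (P : pred L) (X : op S N L) :
  ptr (predC P) X = (ptr P X)^T.
Proof.
apply: opP => s t; rewrite entry_tr !entry_mkop.
by congr entry; apply/ffunP => l; rewrite !ffunE /=; case: (P l).
Qed.

(* X acts in the spaces a, and depends on the others only through the weights
   of the spaces W. *)
Definition local (L : finType) (a : pred L) (W : seq L) (X : op K N L) : Prop :=
  (forall s t : tidx L N, entry X s t != 0 -> forall l, ~~ a l -> s l = t l) /\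
  (forall s t s' t' : tidx L N,
     (forall l, a l -> s l = s' l /\ t l = t' l) ->
     (forall l, ~~ a l -> s l = t l /\ s' l = t' l) ->
     {in W, forall c, mu (t c) = mu (t' c)} ->
     entry X s t = entry X s' t').

Lemma local_predT (L : finType) (X : op K N L) : local predT [::] X.
Proof.
split=> // s t s' t' st _ _.
by congr entry; apply/ffunP => l; have [] := st l isT.
Qed.

Lemma local_emb (J L : finType) (f : J -> L) X lam P :
  local (fun l => l \in codom f) P (emb f X lam P).
Proof.
split=> [s t|s t s' t' st st' W].
  by rewrite entry_emb; case: agree_offP => // _; rewrite eqxx.
rewrite !entry_emb; case: agree_offP => [_|[l /st'[] //]].
case: agree_offP => [_|[l /st'[] //]]; congr (entry (X _) _ _).
- exact: eq_dyn.
- by apply/ffunP => j; rewrite !ffunE; have [] := st _ (codom_f f j).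
- by apply/ffunP => j; rewrite !ffunE; have [] := st _ (codom_f f j).
Qed.

(** In each space of P at most one of X and Y acts, and the other forces equal indices there, so
    nothing is reversed. A shift of X by such a space is read at a different index after
    transposition; it keeps its value because Y conserves that weight, and symmetrically for the
    shifts of Y. *)
Lemma ptr_mul (L : finType) (P a b : pred L) (W W' : seq L) (X Y : op K N L) :
  local a W X -> local b W' Y -> (forall l, P l -> ~~ (a l && b l)) ->
  {in W, forall c, P c -> conserves [:: c] Y} ->
  {in W', forall c, P c -> conserves [:: c] X} ->
  ptr P (X *m Y) = ptr P X *m ptr P Y.
Proof.
move=> [sX iX] [sY iY] Pab WY W'X.
apply: opP => s t; rewrite entry_mkop !entry_mul.
(* Exchanging the values s l and t l of the summation index in the spaces l of P
   is a bijection which matches the terms of the two sums. *)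
pose tw (u : tidx L N) : tidx L N := [ffun l => if P l then tperm (s l) (t l) (u l) else u l].
have twK : involutive tw.
  move=> u; apply/ffunP => l; rewrite !ffunE.
  by case: (P l); rewrite ?tpermK.
rewrite [RHS](reindex_inj (inv_inj twK)) /=; apply: eq_bigr => u _.
rewrite !entry_mkop.
set st := finfun _; set ts := finfun (fun l => if P l then s l else t l).
set su := finfun _; set us := finfun (fun l => if P l then s l else _).
set ut := finfun (fun l => if P l then t l else _); set tu := finfun _.
have nab l : P l -> ~~ a l || ~~ b l by move=> /Pab; rewrite negb_and.
(* A nonzero term on either side already forces these coincidences of indices, under which the terms
   agree; hence they also vanish together. *)
suff eqXY : (forall l, P l -> [/\ ~~ a l -> u l = t l & ~~ b l -> u l = s l]) ->
    (forall l, ~~ P l -> [/\ ~~ a l -> s l = u l & ~~ b l -> u l = t l]) ->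
    {in W, forall c, P c -> mu (u c) = mu (s c)} ->
    {in W', forall c, P c -> mu (s c) = mu (tw u c)} ->
    entry X st u * entry Y u ts = entry X su us * entry Y ut tu.
  have [L0|] := eqVneq (entry X st u * entry Y u ts) 0.
    have [-> //|] := eqVneq (entry X su us * entry Y ut tu) 0.
    rewrite mulf_eq0 negb_or => /andP[X0 Y0].
    have hP l : P l -> [/\ ~~ a l -> u l = t l & ~~ b l -> u l = s l].
      move=> Pl; split=> [al|bl].
        have := sX _ _ X0 l al; rewrite !ffunE Pl => /(canRL (tpermK _ _)).
        by rewrite tpermL.
      have := sY _ _ Y0 l bl; rewrite !ffunE Pl => /esym/(canRL (tpermK _ _)).
      by rewrite tpermR.
    apply: eqXY => //.
    - move=> l Pl; split=> [al|bl].
        by have := sX _ _ X0 l al; rewrite !ffunE (negbTE Pl).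
      by have := sY _ _ Y0 l bl; rewrite !ffunE (negbTE Pl).
    - move=> c cW Pc; have := conserves1P (WY c cW Pc) Y0; rewrite !ffunE Pc.
      have [hu hs] := hP c Pc.
      have /orP[/hu->|/hs-> //] := nab c Pc; by rewrite tpermR.
    - move=> c cW Pc; have := conserves1P (W'X c cW Pc) X0.
      by rewrite !ffunE Pc => ->.
  rewrite mulf_eq0 negb_or => /andP[X0 Y0].
  have hP l : P l -> [/\ ~~ a l -> u l = t l & ~~ b l -> u l = s l].
    move=> Pl; split=> [al|bl].
      by have := sX _ _ X0 l al; rewrite !ffunE Pl.
    by have := sY _ _ Y0 l bl; rewrite !ffunE Pl.
  apply: eqXY => //.
  - move=> l Pl; split=> [al|bl].
      by have := sX _ _ X0 l al; rewrite !ffunE (negbTE Pl).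
    by have := sY _ _ Y0 l bl; rewrite !ffunE (negbTE Pl).
  - by move=> c cW Pc; have := conserves1P (WY c cW Pc) Y0; rewrite !ffunE Pc.
  - move=> c cW Pc; have := conserves1P (W'X c cW Pc) X0; rewrite !ffunE Pc.
    have [hu hs] := hP c Pc => mtu.
    have /orP[/hu->|hb] := nab c Pc; first by rewrite tpermR.
    by rewrite hs // tpermL mtu hs.
move=> hP hN hW hW'; congr (_ * _).
  apply: iX => [l al|l al|c cW].
  - rewrite !ffunE; case: (boolP (P l)) => //= Pl; have [_ hs] := hP l Pl.
    by rewrite hs ?tpermL //; have := nab l Pl; rewrite al.
  - rewrite !ffunE; case: (boolP (P l)) => /= Pl; last by have [/(_ al)] := hN l Pl.
    by have [/(_ al)-> _] := hP l Pl; rewrite tpermR.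
  - by rewrite !ffunE; have := hW c cW; case: (P c) => /= [->|].
apply: iY => [l bl|l bl|c cW].
- rewrite !ffunE; case: (boolP (P l)) => //= Pl; have [hs _] := hP l Pl.
  by rewrite hs ?tpermR //; have := nab l Pl; rewrite bl orbF.
- rewrite !ffunE; case: (boolP (P l)) => /= Pl; last by have [_ /(_ bl)] := hN l Pl.
  by have [_ /(_ bl)->] := hP l Pl; rewrite tpermL.
- by rewrite !ffunE; have := hW' c cW; rewrite ffunE; case: (P c) => /= [->|].
Qed.

(** By [ptr_mul] the transposition in the complement of P keeps the order; it differs from that in P
    by the full transposition, which reverses it. *)
Lemma ptr_mul_rev (L : finType) (P a b : pred L) (W W' : seq L) (X Y : op K N L) :
  local a W X -> local b W' Y -> (forall l, ~~ P l -> ~~ (a l && b l)) ->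
  {in W, forall c, ~~ P c -> conserves [:: c] Y} ->
  {in W', forall c, ~~ P c -> conserves [:: c] X} ->
  ptr P (X *m Y) = ptr P Y *m ptr P X.
Proof.
move=> lX lY Pab WY W'X; apply: (can_inj (@trmxK _ _ _)).
by rewrite trmx_mul -!ptr_predC; apply: (@ptr_mul _ _ a b W W').
Qed.

(** The full transposition reverses the order of X and Y, as always, but also keeps it by [ptr_mul],
    since no space is shared. *)
Lemma local_commute (L : finType) (a b : pred L) (W W' : seq L) (X Y : op K N L) :
  local a W X -> local b W' Y -> (forall l, ~~ (a l && b l)) ->
  {in W, forall c, conserves [:: c] Y} -> {in W', forall c, conserves [:: c] X} ->
  X *m Y = Y *m X.
Proof.
move=> lX lY ab WY W'X; apply: (can_inj (@trmxK _ _ _)).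
rewrite -ptr_predT (@ptr_mul _ _ a b W W') // => [|c /WY|c /W'X] //.
by rewrite !ptr_predT trmx_mul.
Qed.


(** * Two-space operators placed on chosen labels *)

Section Leg2.
Context {L : finType}.
Implicit Types (a b c d : L) (P Q : seq L) (X Y : 'rV[K]_n -> op K N 'I_2).

Lemma pair_inj a b :
  a != b -> injective (fun i : 'I_2 => if i == s1 then a else b).
Proof.
move=> ab i j; have ba : b != a by rewrite eq_sym.
case: i j => [[|[|//]] ?] [[|[|//]] ?] /= => [_|/eqP|/eqP|_];
  by rewrite ?(negbTE ab) ?(negbTE ba) //; apply: val_inj.
Qed.

Lemma codom_pair a b l :
  (l \in codom (fun i : 'I_2 => if i == s1 then a else b)) = (l == a) || (l == b).
Proof.
apply/codomP/orP => [[i ->]|[/eqP->|/eqP->]]; last 2 first.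
- by exists s1.
- by exists s2.
by case: ifP; [left | right].
Qed.

Lemma uniq_pair a b P : uniq [:: a, b & P] ->
  a != b /\ {in P, forall c, c \notin codom (fun i : 'I_2 => if i == s1 then a else b)}.
Proof.
rewrite /= inE negb_or => /and3P[/andP[ab aP] bP _]; split=> // c cP.
rewrite codom_pair; apply: contra aP => /orP[/eqP<- //|/eqP cb].
by rewrite -cb cP in bP.
Qed.

Lemma leg2_mul X Y lam P a b : uniq [:: a, b & P] ->
  leg2 (fun l => X l *m Y l) lam P a b = leg2 X lam P a b *m leg2 Y lam P a b.
Proof. by move=> /uniq_pair[ab Pab]; apply: emb_mul => //; apply: pair_inj. Qed.

Lemma leg2_mulmxV X lam P a b : uniq [:: a, b & P] -> (forall l, X l \in unitmx) ->
  leg2 X lam P a b *m leg2 (fun l => invmx (X l)) lam P a b = 1%:M.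
Proof.
move=> abP Xu; rewrite -leg2_mul // -(emb1 (fun i : 'I_2 => if i == s1 then a else b) lam P).
by apply: eq_emb => // l; rewrite mulmxV.
Qed.

Lemma leg2_flip X lam P a b :
  leg2 (fun l => flip (X l)) lam P a b = leg2 X lam P b a.
Proof.
apply: opP => s t; rewrite !entry_emb entry_mkop.
have r u : [ffun i => restr (fun i : 'I_2 => if i == s1 then a else b) u (rev_ord i)]
  = restr (fun i : 'I_2 => if i == s1 then b else a) u.
  by apply/ffunP => -[[|[|//]] ?]; rewrite !ffunE.
rewrite !r; congr (if _ then _ else _).
by apply: eq_forallb => l; rewrite !codom_pair orbC.
Qed.

Lemma leg2_unit X lam P a b : uniq [:: a, b & P] -> (forall l, X l \in unitmx) ->
  leg2 X lam P a b \in unitmx.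
Proof. by move=> abP Xu; have /mulmx1_unit[] := leg2_mulmxV lam abP Xu. Qed.

Lemma leg2_inv X lam P a b : uniq [:: a, b & P] -> (forall l, X l \in unitmx) ->
  leg2 (fun l => invmx (X l)) lam P a b = invmx (leg2 X lam P a b).
Proof.
move=> abP Xu; rewrite -[RHS]mulmx1 -(leg2_mulmxV lam abP Xu).
by rewrite mulKmx // leg2_unit.
Qed.

Definition conserves_on (Z : pred 'I_2) X : Prop :=
  forall i, Z i -> forall l, conserves [:: i] (X l).

Lemma conserves_leg2 Z X lam P a b c : conserves_on Z X -> a != b ->
  kept Z a b c -> conserves [:: c] (leg2 X lam P a b).
Proof.
move=> cX ab /andP[/implyP ca /implyP cb].
have [/eqP ca'|ca'] := boolP (c == a).
  by rewrite ca'; apply: (conserves_emb (j := s1) (pair_inj ab)); apply/cX/ca/eqP.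
have [/eqP cb'|cb'] := boolP (c == b).
  by rewrite cb'; apply: (conserves_emb (j := s2) (pair_inj ab)); apply/cX/cb/eqP.
by apply: conserves_out; rewrite codom_pair negb_or ca'.
Qed.

Lemma leg2_commute Z Z' X Y lam P Q a b c d :
  conserves_on Z X -> conserves_on Z' Y -> uniq [:: a; b; c; d] ->
  all (kept Z a b) Q -> all (kept Z' c d) P ->
  leg2 X lam P a b *m leg2 Y lam Q c d = leg2 Y lam Q c d *m leg2 X lam P a b.
Proof.
move=> cX cY; rewrite /= !inE !negb_or => /and4P[/and3P[ab ac ad] /andP[bc bd] cd _].
move=> /allP kQ /allP kP.
apply: (local_commute (local_emb _ _ _ _) (local_emb _ _ _ _)).
- move=> l; rewrite !codom_pair; apply/negP => /andP[].
  case/orP=> /eqP->; rewrite ?(negbTE ac) ?(negbTE ad) ?(negbTE bc) ?(negbTE bd) //.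
- by move=> l lP; exact: (conserves_leg2 cY cd (kP l lP)).
- by move=> l lQ; exact: (conserves_leg2 cX ab (kQ l lQ)).
Qed.

Lemma ptr_leg2 (T : pred L) X lam P a b : uniq [:: a, b & P] ->
  ptr T (leg2 X lam P a b) =
  leg2 (fun l => ptr (fun i => if i == s1 then T a else T b) (X l)) lam P a b.
Proof.
move=> /uniq_pair[_ Pab]; rewrite ptr_emb //; apply: eq_emb => // l.
by apply: eq_ptr => i /=; case: ifP.
Qed.

Lemma emb_leg2 (J : finType) (g : J -> L) X lam (P : seq J) Q (i j : J) : injective g ->
  emb g (fun l => leg2 X l P i j) lam Q = leg2 X lam (map g P ++ Q) (g i) (g j).
Proof.
by move=> g_inj; rewrite emb_emb //; apply: eq_emb => // k /=; case: ifP.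
Qed.

End Leg2.

Lemma emb_mul3 (J L : finType) (g : J -> L) (X Y Z X' Y' Z' : 'rV[K]_n -> op K N J) :
  injective g ->
  (forall l, X l *m Y l *m Z l = X' l *m Y' l *m Z' l) -> forall lam,
  emb g X lam [::] *m emb g Y lam [::] *m emb g Z lam [::] =
  emb g X' lam [::] *m emb g Y' lam [::] *m emb g Z' lam [::].
Proof.
by move=> g_inj E lam; rewrite -!emb_mul //; apply: eq_emb.
Qed.

Lemma nth3_inj (L : eqType) (a b c : L) :
  uniq [:: a; b; c] -> injective (fun i : 'I_3 => nth a [:: a; b; c] i).
Proof.
by move=> abc i j /eqP; rewrite nth_uniq ?ltn_ord // => /eqP/val_inj.
Qed.


(** * Cubic relations between inverses *)

Section InverseRelations.
Variable m : nat.
Implicit Types A X Y Z : 'M[K]_m.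

Lemma invmx_mul X Y :
  X \in unitmx -> Y \in unitmx -> invmx (X *m Y) = invmx Y *m invmx X.
Proof.
move=> uX uY; have uXY : X *m Y \in unitmx by rewrite unitmx_mul uX.
by rewrite -[RHS](mulmxK uXY) -!mulmxA mulKmx // mulKmx // mul1mx.
Qed.

Lemma invmx_mul3 X Y Z X' Y' Z' :
  X \in unitmx -> Y \in unitmx -> Z \in unitmx ->
  X' \in unitmx -> Y' \in unitmx -> Z' \in unitmx ->
  X *m Y *m Z = X' *m Y' *m Z' ->
  invmx Z *m invmx Y *m invmx X = invmx Z' *m invmx Y' *m invmx X'.
Proof.
move=> uX uY uZ uX' uY' uZ' /(congr1 invmx).
by rewrite !invmx_mul ?unitmx_mul ?uX ?uX' // !mulmxA.
Qed.

(** The equation expresses A' as (Y X)^-1 A X Y, and both claims follow by cancelling. The second is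
    the source of the relation that mixes C^t with its inverse around A. *)
Lemma invmx_exchange A A' X Y : X \in unitmx -> Y \in unitmx ->
  A *m X *m Y = Y *m X *m A' ->
  invmx X *m invmx Y *m A = A' *m invmx Y *m invmx X /\
  X *m A' *m invmx Y = invmx Y *m A *m X.
Proof.
move=> uX uY E; have -> : A' = invmx X *m (invmx Y *m (A *m X *m Y)).
  by rewrite E -!mulmxA !mulKmx.
by rewrite !mulmxA !mulmxK // mulmxV // mul1mx.
Qed.

End InverseRelations.

(** * Transposed relations *)

Section YangBaxter.
Variables A C D : 'rV[K]_n -> op K N 'I_2.
Hypothesis C_weight : conserves_on (pred1 s2) C.
Hypothesis Ct_unit : forall lam, ptr (pred1 s2) (C lam) \in unitmx.
Hypothesis Dt_unit : forall lam, ptr predT (D lam) \in unitmx.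

Let Ct lam := ptr (pred1 s2) (C lam).
Let Dt lam := ptr predT (D lam).
Let Ci lam := invmx (Ct lam).
Let Di lam := invmx (Dt lam).
Local Notation leg2_3 X lam := (Defs.leg2 gamma mu (L := 'I_3) X lam).

Hypothesis hAAA : forall lam, let A_ := leg2_3 A lam in
  A_ [::] s1 s2 *m A_ [::] s1 s3 *m A_ [::] s2 s3
  = A_ [::] s2 s3 *m A_ [::] s1 s3 *m A_ [::] s1 s2.
Hypothesis hDDD : forall lam, let D_ := leg2_3 D lam in
  D_ [:: s3] s1 s2 *m D_ [::] s1 s3 *m D_ [:: s1] s2 s3
  = D_ [::] s2 s3 *m D_ [:: s2] s1 s3 *m D_ [::] s1 s2.
Hypothesis hDCC : forall lam, let C_ := leg2_3 C lam in let D_ := leg2_3 D lam in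
  D_ [::] s1 s2 *m C_ [::] s3 s1 *m C_ [:: s1] s3 s2
  = C_ [::] s3 s2 *m C_ [:: s2] s3 s1 *m D_ [::] s1 s2.
Hypothesis hACC : forall lam, let A_ := leg2_3 A lam in let C_ := leg2_3 C lam in
  A_ [::] s1 s2 *m C_ [::] s1 s3 *m C_ [::] s2 s3
  = C_ [::] s2 s3 *m C_ [::] s1 s3 *m A_ [:: s3] s1 s2.

Lemma Ct_weight : conserves_on (pred1 s2) Ct.
Proof. by move=> i si l; apply: conserves_ptr; apply: (C_weight si). Qed.

Lemma Ci_weight : conserves_on (pred1 s2) Ci.
Proof. by move=> i si l; apply: (conserves_inv (Ct_unit l)); apply: (Ct_weight si). Qed.

(** For the empty predicate, [kept] says that the shift lies in neither leg. In this form A and the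
    inverse of D^{tt} enter the commutations, as they may change the weight of either of their
    spaces. *)
Lemma any_weight X : conserves_on pred0 X.
Proof. by []. Qed.

Lemma ptr_leg2_at (L : finType) (T : pred L) (T' : pred 'I_2) X lam P (a b : L) :
  uniq [:: a, b & P] -> T' s1 = T a -> T' s2 = T b ->
  ptr T (leg2 X lam P a b) = leg2 (fun l => ptr T' (X l)) lam P a b.
Proof.
move=> abP Ta Tb; rewrite ptr_leg2 //; apply: eq_emb => // l; apply: eq_ptr => i.
by case: i => [[|[|//]] ilt]; rewrite /= -?Ta -?Tb; congr T'; apply: val_inj.
Qed.

Lemma ptr_leg2_id (L : finType) (T : pred L) X lam P (a b : L) :
  uniq [:: a, b & P] -> ~~ T a -> ~~ T b ->
  ptr T (leg2 X lam P a b) = leg2 X lam P a b.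
Proof.
move=> abP /negbTE Ta /negbTE Tb; rewrite (ptr_leg2_at (T' := pred0)) ?Ta ?Tb //.
by apply: eq_emb => // l; rewrite ptr_pred0.
Qed.

(** Transposition in space 3, which A does not meet: C_13 and C_23 share only that space, so they
    change order while A stays in place. Moving the transposition past the shift of A by h_3 is
    harmless, since space 3 is the second factor of both C, whose weight they conserve. *)
Lemma A_Ct_Ct lam :
  leg2_3 A lam [::] s1 s2 *m leg2_3 Ct lam [::] s2 s3 *m leg2_3 Ct lam [::] s1 s3 =
  leg2_3 Ct lam [::] s1 s3 *m leg2_3 Ct lam [::] s2 s3 *m leg2_3 A lam [:: s3] s1 s2.
Proof.
have ptrC a : a != s3 ->
    ptr (pred1 s3) (leg2_3 C lam [::] a s3) = leg2_3 Ct lam [::] a s3.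
  move=> a3; rewrite (ptr_leg2_at (T' := pred1 s2)) ?(negbTE a3) //=;
  by rewrite ?inE ?a3 ?(negbTE a3).
have := congr1 (ptr (pred1 s3)) (hACC lam) => /=.
rewrite -mulmxA (ptr_mul (local_emb _ _ _ _) (local_predT _)) //; last first.
  by move=> l /= /eqP ->; rewrite codom_pair.
rewrite (ptr_mul_rev (local_emb _ _ _ _) (local_emb _ _ _ _)) //; last first.
  by move=> l /= l3; rewrite !codom_pair (negbTE l3) !orbF; apply/negP => /andP[/eqP->].
rewrite (ptr_mul (local_predT _) (local_emb _ _ _ _)) //; last 2 first.
- by move=> l /= /eqP ->; rewrite codom_pair.
- move=> l; rewrite inE => /eqP -> _; apply: conserves_mul;
    exact: (conserves_leg2 C_weight).
rewrite (ptr_mul_rev (local_emb _ _ _ _) (local_emb _ _ _ _)) //; last first.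
  by move=> l /= l3; rewrite !codom_pair (negbTE l3) !orbF; apply/negP => /andP[/eqP->].
by rewrite !ptrC // !ptr_leg2_id // mulmxA.
Qed.

(** Transposition in spaces 1 and 2: D meets the two C only there and changes sides, while the C
    share only space 3 and keep their order. The space in the shift of one C is the second factor of
    the other, which conserves its weight. *)
Lemma Ct_Ct_Dt lam :
  leg2_3 Ct lam [::] s3 s1 *m leg2_3 Ct lam [:: s1] s3 s2 *m leg2_3 Dt lam [::] s1 s2 =
  leg2_3 Dt lam [::] s1 s2 *m leg2_3 Ct lam [::] s3 s2 *m leg2_3 Ct lam [:: s2] s3 s1.
Proof.
have ptrC a P : uniq [:: s3, a & P] ->
    ptr (predC1 s3) (leg2_3 C lam P s3 a) = leg2_3 Ct lam P s3 a.
  move=> aP; apply: ptr_leg2_at => //=.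
  by move: aP; rewrite /= !inE negb_or => /and3P[/andP[]]; rewrite eq_sym => ->.
have ptrD : ptr (predC1 s3) (leg2_3 D lam [::] s1 s2) = leg2_3 Dt lam [::] s1 s2.
  exact: ptr_leg2_at.
have := congr1 (ptr (predC1 s3)) (hDCC lam) => /=.
rewrite -mulmxA (ptr_mul_rev (local_emb _ _ _ _) (local_predT _)) //; last first.
  by move=> l /negPn /eqP ->; rewrite codom_pair.
rewrite (ptr_mul (local_emb _ _ _ _) (local_emb _ _ _ _)) //; last 2 first.
- by move=> l /= l3; rewrite !codom_pair (negbTE l3) /=; apply/negP => /andP[/eqP->].
- by move=> l; rewrite inE => /eqP -> _; exact: (conserves_leg2 C_weight).
rewrite (ptr_mul_rev (local_predT _) (local_emb _ _ _ _)) //; last first.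
  by move=> l /negPn /eqP ->; rewrite codom_pair.
rewrite (ptr_mul (local_emb _ _ _ _) (local_emb _ _ _ _)) //; last 2 first.
- by move=> l /= l3; rewrite !codom_pair (negbTE l3) /=; apply/negP => /andP[/eqP->].
- by move=> l; rewrite inE => /eqP -> _; exact: (conserves_leg2 C_weight).
by rewrite !ptrC // !ptrD mulmxA.
Qed.

Lemma Dt_Dt_Dt lam :
  leg2_3 Dt lam [:: s1] s2 s3 *m leg2_3 Dt lam [::] s1 s3 *m leg2_3 Dt lam [:: s3] s1 s2 =
  leg2_3 Dt lam [::] s1 s2 *m leg2_3 Dt lam [:: s2] s1 s3 *m leg2_3 Dt lam [::] s2 s3.
Proof.
have ptrD P a b : uniq [:: a, b & P] ->
    (leg2_3 D lam P a b)^T = leg2_3 Dt lam P a b.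
  by move=> abP; rewrite -ptr_predT; apply: ptr_leg2_at.
have := congr1 trmx (hDDD lam).
by rewrite /= !trmx_mul !ptrD // !mulmxA.
Qed.

(** * The relations on any three distinct labels, and their forms with inverses *)

Section Transport.
Variables (L : finType) (lam : 'rV[K]_n) (a b c : L).
Hypothesis abc : uniq [:: a; b; c].
Local Notation leg2_L X := (Defs.leg2 gamma mu (L := L) X lam).

Lemma AAA_L : leg2_L A [::] a b *m leg2_L A [::] a c *m leg2_L A [::] b c =
  leg2_L A [::] b c *m leg2_L A [::] a c *m leg2_L A [::] a b.
Proof.
by have := emb_mul3 (nth3_inj abc) hAAA lam; rewrite !emb_leg2 //; apply: nth3_inj.
Qed.

Lemma A_Ct_Ct_L :
  leg2_L A [::] a b *m leg2_L Ct [::] b c *m leg2_L Ct [::] a c =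
  leg2_L Ct [::] a c *m leg2_L Ct [::] b c *m leg2_L A [:: c] a b.
Proof.
by have := emb_mul3 (nth3_inj abc) A_Ct_Ct lam; rewrite !emb_leg2 //; apply: nth3_inj.
Qed.

Lemma Ct_Ct_Dt_L :
  leg2_L Ct [::] c a *m leg2_L Ct [:: a] c b *m leg2_L Dt [::] a b =
  leg2_L Dt [::] a b *m leg2_L Ct [::] c b *m leg2_L Ct [:: b] c a.
Proof.
by have := emb_mul3 (nth3_inj abc) Ct_Ct_Dt lam; rewrite !emb_leg2 //; apply: nth3_inj.
Qed.

Lemma Dt_Dt_Dt_L :
  leg2_L Dt [:: a] b c *m leg2_L Dt [::] a c *m leg2_L Dt [:: c] a b =
  leg2_L Dt [::] a b *m leg2_L Dt [:: b] a c *m leg2_L Dt [::] b c.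
Proof.
by have := emb_mul3 (nth3_inj abc) Dt_Dt_Dt lam; rewrite !emb_leg2 //; apply: nth3_inj.
Qed.


Let neq : (((a != b) * (a != c) * (b != c)) * ((b != a) * (c != a) * (c != b)))%type.
Proof.
move: abc; rewrite /= !inE negb_or => /and3P[/andP[ab ac] bc _].
by rewrite ![b == a]eq_sym ![c == _]eq_sym ab ac bc.
Qed.

Let uniqE := (inE, negb_or, neq).

Let unit_legs P (x y : L) (u : uniq [:: x, y & P]) :=
  (leg2_unit lam u Ct_unit, leg2_unit lam u Dt_unit).
Let inv_legs P (x y : L) (u : uniq [:: x, y & P]) :=
  (leg2_inv lam u Ct_unit, leg2_inv lam u Dt_unit).

Lemma Ci_Ci_A :
  leg2_L Ci [::] b c *m leg2_L Ci [::] a c *m leg2_L A [::] a b =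
  leg2_L A [:: c] a b *m leg2_L Ci [::] a c *m leg2_L Ci [::] b c.
Proof.
have ubc : uniq [:: b; c] by rewrite /= !uniqE.
have uac : uniq [:: a; c] by rewrite /= !uniqE.
rewrite (inv_legs ubc) (inv_legs uac).
by have [] := invmx_exchange (unit_legs ubc).1 (unit_legs uac).1 A_Ct_Ct_L.
Qed.

Lemma Ct_A_Ci :
  leg2_L Ct [::] b c *m leg2_L A [:: c] a b *m leg2_L Ci [::] a c =
  leg2_L Ci [::] a c *m leg2_L A [::] a b *m leg2_L Ct [::] b c.
Proof.
have ubc : uniq [:: b; c] by rewrite /= !uniqE.
have uac : uniq [:: a; c] by rewrite /= !uniqE.
rewrite (inv_legs uac).
by have [] := invmx_exchange (unit_legs ubc).1 (unit_legs uac).1 A_Ct_Ct_L.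
Qed.

Lemma Di_Ci_Ci :
  leg2_L Di [::] a b *m leg2_L Ci [:: a] c b *m leg2_L Ci [::] c a =
  leg2_L Ci [:: b] c a *m leg2_L Ci [::] c b *m leg2_L Di [::] a b.
Proof.
have uab : uniq [:: a; b] by rewrite /= !uniqE.
have uca : uniq [:: c; a] by rewrite /= !uniqE.
have ucb : uniq [:: c; b] by rewrite /= !uniqE.
have ucab : uniq [:: c; a; b] by rewrite /= !uniqE.
have ucba : uniq [:: c; b; a] by rewrite /= !uniqE.
rewrite !(inv_legs uab, inv_legs uca, inv_legs ucb, inv_legs ucab, inv_legs ucba).
by apply: invmx_mul3 Ct_Ct_Dt_L; rewrite unit_legs.
Qed.

Lemma Ct_Ct_Di :
  leg2_L Ct [::] c b *m leg2_L Ct [:: b] c a *m leg2_L Di [::] a b =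
  leg2_L Di [::] a b *m leg2_L Ct [::] c a *m leg2_L Ct [:: a] c b.
Proof.
have uab : uniq [:: a; b] by rewrite /= !uniqE.
rewrite (inv_legs uab); apply: (can_inj (mulKmx (unit_legs uab).2)).
rewrite !mulmxA -Ct_Ct_Dt_L mulmxK ?(unit_legs uab) //.
by rewrite mulmxV ?mul1mx ?(unit_legs uab).
Qed.

(** This is [Ct_Ct_Di] with C^t in (c, b) cancelled on both sides, unshifted on the left and shifted
    by h_a on the right. *)
Lemma Ci_Di_Ct :
  leg2_L Ci [::] c b *m leg2_L Di [::] a b *m leg2_L Ct [::] c a =
  leg2_L Ct [:: b] c a *m leg2_L Di [::] a b *m leg2_L Ci [:: a] c b.
Proof.
have ucb : uniq [:: c; b] by rewrite /= !uniqE.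
have ucba : uniq [:: c; b; a] by rewrite /= !uniqE.
rewrite (inv_legs ucb) (inv_legs ucba).
apply: (can_inj (mulKmx (unit_legs ucb).1)).
apply: (can_inj (mulmxK (unit_legs ucba).1)).
rewrite !mulmxA mulmxKV ?(unit_legs ucba) // mulmxV ?(unit_legs ucb) //.
by rewrite mul1mx Ct_Ct_Di.
Qed.

(** Transposition and inversion each reverse the order, so the dynamical Yang-Baxter equation of D
    returns in its original form. *)
Lemma Di_Di_Di :
  leg2_L Di [:: c] a b *m leg2_L Di [::] a c *m leg2_L Di [:: a] b c =
  leg2_L Di [::] b c *m leg2_L Di [:: b] a c *m leg2_L Di [::] a b.
Proof.
have uab : uniq [:: a; b] by rewrite /= !uniqE.
have uac : uniq [:: a; c] by rewrite /= !uniqE.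
have ubc : uniq [:: b; c] by rewrite /= !uniqE.
have uabc : uniq [:: a; b; c] by rewrite /= !uniqE.
have ubca : uniq [:: b; c; a] by rewrite /= !uniqE.
have uacb : uniq [:: a; c; b] by rewrite /= !uniqE.
rewrite !(inv_legs uab, inv_legs uac, inv_legs ubc, inv_legs uabc, inv_legs ubca,
  inv_legs uacb).
by apply: invmx_mul3 Dt_Dt_Dt_L; rewrite unit_legs.
Qed.

End Transport.


Definition exchange_mx lam (P : seq space) (p q : 'I_3) :=
  leg2 Ci lam P (p, false) (q, true) *m leg2 Di lam P (p, true) (q, true)
  *m leg2 A lam P (p, false) (q, false) *m leg2 Ct lam P (q, false) (p, true).

Lemma exchange_mx_yang_baxter lam :
  exchange_mx lam [::] s2 s3 *m exchange_mx lam [:: (s2, true)] s1 s3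
    *m exchange_mx lam [::] s1 s2 =
  exchange_mx lam [:: (s3, true)] s1 s2 *m exchange_mx lam [::] s1 s3
    *m exchange_mx lam [:: (s1, true)] s2 s3.
Proof.
have ex Z Z' X Y : conserves_on Z X -> conserves_on Z' Y ->
    exchangeable (L := space) Z Z' (leg2 X lam) (leg2 Y lam).
  move=> cX cY P Q a b c d; exact: leg2_commute.
have [A0 D0] := (@any_weight A, @any_weight Di).
have [Ct2 Ci2] := (Ct_weight, Ci_weight).
apply: (yang_baxter_words (a := leg2 A lam) (c := leg2 Ci lam) (d := leg2 Di lam)
  (t := leg2 Ct lam)).
- exact: (ex _ _ _ _ Ct2 Ci2).
- exact: (ex _ _ _ _ A0 Ci2).
- exact: (ex _ _ _ _ Ct2 D0).
- exact: (ex _ _ _ _ A0 D0).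
- exact: (ex _ _ _ _ D0 Ci2).
- exact: (ex _ _ _ _ Ct2 A0).
- exact: (ex _ _ _ _ Ct2 Ct2).
- exact: (ex _ _ _ _ Ci2 Ci2).
- move=> x y z u; split;
    [exact: AAA_L | exact: Di_Di_Di | exact: A_Ct_Ct_L | exact: Ci_Ci_A | exact: Ct_A_Ci].
- move=> x y z u; split; [exact: Di_Ci_Ci | exact: Ct_Ct_Di | exact: Ci_Di_Ct].
Qed.

End YangBaxter.


(** * The exchange relations on bivectors *)

Lemma conserves_hact (L : finType) (W : seq L) (X : op K N L) :
  (forall h, comm_mx (\sum_(c <- W) hact mu h c) X) -> conserves W X.
Proof.
move=> hX; apply/conserves_comm => j; apply: comm_mx_sym.
(* Testing with h_j alone isolates the j-th coordinate of the weights. *)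
have -> // : diag_mx (\row_i (\sum_(c <- W) mu ((enum_val i : tidx L N) c)) 0 j) =
  \sum_(c <- W) hact mu (delta_mx 0 j) c.
apply/matrixP => x y; rewrite summxE !mxE summxE -sumrMnl.
apply: eq_bigr => c _; rewrite !mxE; congr (_ *+ _).
rewrite (bigD1 j) //= big1 ?addr0 => [|k kj]; first by rewrite mxE !eqxx mul1r.
by rewrite mxE (negbTE kj) mul0r.
Qed.

Lemma conserves_emb_map (J L : finType) (f : J -> L) X lam P (W : seq J) :
  (forall l, conserves W (X l)) -> conserves (map f W) (emb f X lam P).
Proof.
move=> cX s t; rewrite entry_emb; case: ifP => [_|]; last by rewrite eqxx.
move=> /cX; rewrite !big_map => E.
by transitivity (\sum_(c <- W) mu (restr f s c)); [|rewrite E];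
  apply: eq_bigr => c _; rewrite ffunE.
Qed.

Lemma conserves_predT (L : finType) (W : seq L) (X : op K N L) :
  conserves W X -> conserves W (ptr predT X).
Proof. by move=> cX s t; rewrite ptr_predT entry_tr => /cX ->. Qed.

Lemma ptr_flip (X : op K N 'I_2) (P : pred 'I_2) :
  ptr P (flip X) = flip (ptr (P \o @rev_ord 2) X).
Proof.
apply: opP => s t; rewrite !entry_mkop.
by congr entry; apply/ffunP => i; rewrite !ffunE.
Qed.

Definition pair_space {k : nat} (p q : 'I_k) (u : 'I_2 * bool) : 'I_k * bool :=
  (if u.1 == s1 then p else q, u.2).

Lemma pair_space_inj k (p q : 'I_k) : p != q -> injective (pair_space p q).
Proof. by move=> pq [i x] [j y] [/(pair_inj pq)-> ->]. Qed.

Lemma pair_space_out k (p q r : 'I_k) x :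
  r != p -> r != q -> (r, x) \notin codom (pair_space p q).
Proof.
move=> rp rq; apply/codomP => -[u [ru _]]; move: rp rq; rewrite ru.
by case: ifP; rewrite eqxx.
Qed.

(** * Matrices of generators as bivectors *)

Section Generators.
Variables (alg : algType K) (T : 'rV[K]_n -> 'M[alg]_N).
Local Notation scal := (scal alg).
Local Notation leg1 := (leg1 gamma mu T).
Local Notation Tword := (Tword gamma mu T).
Local Notation Tprod := (Tprod gamma mu T).

Lemma entry_scal (L : finType) (X : op K N L) s t :
  entry (scal X) s t = (entry X s t)%:A.
Proof. by rewrite /entry mxE. Qed.

Lemma scal_mul (p q r : nat) (X : 'M[K]_(p, q)) (Y : 'M[K]_(q, r)) :
  scal (X *m Y) = scal X *m scal Y.
Proof. exact: map_mxM. Qed.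

Lemma scal1 (p : nat) : scal (1%:M : 'M_p) = 1%:M.
Proof. exact: map_mx1. Qed.

Definition ventry (L : finType) (v : tvec alg N L) s : alg := v (enum_rank s) 0.

Lemma tvecP (L : finType) (v w : tvec alg N L) : ventry v =1 ventry w -> v = w.
Proof.
move=> vw; apply/colP => i; rewrite -(enum_valK i); exact: vw.
Qed.

Lemma ventry_Tprod (k : nat) lam ps (s : tidx ('I_k * bool)%type N) :
  ventry (Tprod lam ps) s = Tword s lam ps.
Proof. by rewrite /ventry mxE enum_rankK. Qed.

Lemma ventry_scal (L : finType) (X : op K N L) v s :
  ventry (scal X *m v) s = \sum_t entry X s t *: ventry v t.
Proof.
rewrite /ventry mxE sum_enum_rank; apply: eq_bigr => t _.
by rewrite mxE mulr_algl.
Qed.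

Lemma ventry_emb (J L : finType) (f : J -> L) X lam P v s :
  injective f -> {in P, forall c, c \notin codom f} ->
  ventry (scal (emb f X lam P) *m v) s =
  \sum_w entry (X (dyn lam P s)) (restr f s) w *: ventry v (insert f s w).
Proof.
move=> f_inj Pf; rewrite ventry_scal.
rewrite (@emb_sum _ _ f X lam P s _ (fun x t => x *: ventry v t)) // => t.
by rewrite scale0r.
Qed.

Lemma dyn_nil (L : finType) lam (s : tidx L N) : dyn lam [::] s = lam.
Proof. by rewrite /dyn /Defs.dyn big_nil scaler0 addr0. Qed.

(* Row indices become the spaces 1, 2 and column indices the spaces 1', 2'. *)
Definition bivec (M : op alg N 'I_2) : tvec alg N ('I_2 * bool)%type :=
  \col_i entry M (restr (fun j => (j, false)) (enum_val i))
                 (restr (fun j => (j, true)) (enum_val i)).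

Lemma ventry_bivec M s :
  ventry (bivec M) s =
  entry M (restr (fun j => (j, false)) s) (restr (fun j => (j, true)) s).
Proof. by rewrite /ventry mxE enum_rankK. Qed.

Lemma bivec_inj : injective bivec.
Proof.
move=> M M' MM; apply: opP => s t.
pose st : tidx ('I_2 * bool)%type N := [ffun u => if u.2 then t u.1 else s u.1].
have := congr1 (fun v => ventry v st) MM; rewrite /= !ventry_bivec.
have -> : restr (fun j => (j, false)) st = s by apply/ffunP => j; rewrite !ffunE.
by have -> : restr (fun j => (j, true)) st = t by apply/ffunP => j; rewrite !ffunE.
Qed.

Lemma emb_leg2E (L : finType) (f : 'I_2 -> L) X lam P :
  leg2 X lam P (f s1) (f s2) = emb f X lam P.
Proof.
apply: eq_emb => // -[[|[|//]] ?] /=; by congr f; apply: val_inj.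
Qed.

Lemma label_inj (b : bool) : injective (fun j : 'I_2 => (j, b)).
Proof. by move=> i j []. Qed.

Lemma label_out (b : bool) (j : 'I_2) : (j, ~~ b) \notin codom (fun j : 'I_2 => (j, b)).
Proof. by apply/codomP => -[i [_]]; case: b. Qed.

Lemma bivec_scal_l X lam M :
  bivec (scal (X lam) *m M) =
  scal (leg2 X lam [::] (s1, false) (s2, false)) *m bivec M.
Proof.
have fi := @label_inj false; apply: tvecP => s.
rewrite (emb_leg2E (fun j => (j, false))) ventry_emb // dyn_nil ventry_bivec.
rewrite entry_mul; apply: eq_bigr => w _.
rewrite ventry_bivec restr_insert // entry_scal mulr_algl; congr (_ *: entry M _ _).
by apply/ffunP => j; rewrite [LHS]ffunE [RHS]ffunE insert_out // (label_out false).
Qed.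

(** Right multiplication contracts column indices, which sit in the primed spaces; as an operator
    acting from the left it is the transpose. *)
Lemma bivec_scal_r X lam M :
  bivec (M *m scal (X lam)) =
  scal (leg2 (fun l => ptr predT (X l)) lam [::] (s1, true) (s2, true)) *m bivec M.
Proof.
have fi := @label_inj true; apply: tvecP => s.
rewrite (emb_leg2E (fun j => (j, true))) ventry_emb // dyn_nil ventry_bivec.
rewrite entry_mul; apply: eq_bigr => w _.
rewrite ventry_bivec restr_insert // entry_scal mulr_algr ptr_predT entry_tr.
congr (_ *: entry M _ _).
by apply/ffunP => j; rewrite [LHS]ffunE [RHS]ffunE insert_out // (label_out true).
Qed.

Lemma entry_leg1 (L : finType) lam P (a : L) s t :
  entry (leg1 lam P a) s t =
  if [forall l, (l != a) ==> (s l == t l)] then T (dyn lam P t) (s a) (t a) else 0.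
Proof. exact: entry_mkop. Qed.

(** X contracts the column index of the T before it with the row index of the T after it, so it acts
    in a' by its transpose and in b directly: B in 1', 2 for a = 1, and C in 1, 2' for a = 2. On the
    left the second T is shifted by the weight of the outer column index of a, in [Tprod] by that of
    the contracted one; they agree because X conserves the weight in a. *)
Lemma bivec_scal_mid (a b : 'I_2) X lam :
  a != b -> conserves [:: a] (X lam) ->
  bivec (leg1 lam [::] a *m scal (X lam) *m leg1 lam [:: a] b) =
  scal (leg2 (fun l => ptr (pred1 a) (X l)) lam [::] (s1, s1 == a) (s2, s2 == a))
    *m Tprod lam [:: a; b].
Proof.
move=> ab cX; have ba : b != a by rewrite eq_sym.
have ord2 (j : 'I_2) : j = a \/ j = b.
  by apply/pred2P; move: a b ab {ba cX} j => [[|[|//]] ?] [[|[|//]] ?] ? [[|[|//]] ?].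
apply: tvecP => s; rewrite ventry_bivec.
set s0 := restr _ s; set s1' := restr _ s.
have s0E j : s0 j = s (j, false) by rewrite ffunE.
have s1E j : s1' j = s (j, true) by rewrite ffunE.
move: s0 s1' s0E s1E => s0 s1' s0E s1E.
pose f (j : 'I_2) := (j, j == a); have f_inj : injective f by move=> i j [].
rewrite (emb_leg2E f) ventry_emb // dyn_nil.
pose F (uv : tidx 'I_2 N * tidx 'I_2 N) : alg :=
  entry (X lam) uv.1 uv.2 *: (T lam (s0 a) (uv.1 a) *
    T (lam + gamma *: mu (s1' a)) (uv.2 b) (s1' b)).
have others (x y : 'I_2) (u v : tidx 'I_2 N) : x != y -> (forall j, j = x \/ j = y) ->
    [forall l, (l != x) ==> (u l == v l)] = (u y == v y).
  move=> xy jxy; apply/forallP/idP => [/(_ y)|uv l]; first by rewrite eq_sym xy.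
  by have [->|->] := jxy l; rewrite ?eqxx // uv implybT.
(* Each [leg1] is the identity in the space where its T does not act, which fixes u in b and v in
   a. *)
transitivity (\sum_(uv : tidx 'I_2 N * tidx 'I_2 N |
    (uv.1 b == s0 b) && (uv.2 a == s1' a)) F uv).
  rewrite entry_mul.
  under eq_bigr => v _ do rewrite entry_mul mulr_suml.
  rewrite exchange_big pair_bigA [RHS]big_mkcond; apply: eq_bigr => -[u v] _ /=.
  rewrite !entry_leg1 (others a b) // (others b a) //; last by move=> j; apply/or_comm.
  rewrite dyn_nil {1}/Defs.dyn big_seq1 entry_scal eq_sym.
  case: (u b == s0 b); rewrite ?mul0r //=.
  by case: (v a == s1' a); rewrite ?mulr0 // mulr_algr -scalerAl.
(* w collects the contracted indices: [w a] is the column index of the first T, [w b] the row index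
   of the second. *)
pose h (w : tidx 'I_2 N) : tidx 'I_2 N * tidx 'I_2 N :=
  ([ffun j => if j == a then w a else s0 b], [ffun j => if j == a then s1' a else w b]).
pose h' (uv : tidx 'I_2 N * tidx 'I_2 N) : tidx 'I_2 N :=
  [ffun j => if j == a then uv.1 a else uv.2 b].
rewrite (reindex_onto h h') /=; last first.
  move=> [u v] /= /andP[/eqP ub /eqP va]; congr pair; apply/ffunP => j;
  by rewrite !ffunE; have [->|->] := ord2 j; rewrite ?eqxx ?(negbTE ba) ?ub ?va.
apply: eq_big => [w|w _].
  rewrite !ffunE eqxx (negbTE ba) !eqxx /=; apply/eqP/ffunP => j.
  by rewrite !ffunE; have [->|->] := ord2 j; rewrite ?eqxx ?(negbTE ba).
have -> : entry (ptr (pred1 a) (X lam)) (restr f s) w = entry (X lam) (h w).1 (h w).2.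
  rewrite entry_mkop; congr entry; apply/ffunP => j; rewrite !ffunE /f /=;
  by have [->|->] := ord2 j; rewrite ?eqxx ?(negbTE ba) ?s0E ?s1E /= ?eqxx ?(negbTE ba).
rewrite /F; have [->|/(conserves1P cX)] := eqVneq (entry (X lam) (h w).1 (h w).2) 0.
  by rewrite !scale0r.
rewrite ventry_Tprod [Tword _ _ _]/=.
have -> : (h w).1 a = w a by rewrite ffunE eqxx.
have -> : (h w).2 b = w b by rewrite ffunE (negbTE ba).
have -> : (h w).2 a = s1' a by rewrite ffunE eqxx.
move=> mua; congr (_ *: _).
have fa : (a, true) = f a by rewrite /f eqxx.
have fb : (b, false) = f b by rewrite /f (negbTE ba).
have out j : (j, j != a) \notin codom f by apply/codomP => -[i [->]]; case: (_ == _).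
have outa : (a, false) \notin codom f by have := out a; rewrite eqxx.
have outb : (b, true) \notin codom f by have := out b; rewrite ba.
rewrite !(insert_out _ _ outa) !(insert_out _ _ outb) fa fb !insert_in //.
by rewrite mua !s0E !s1E mulr1.
Qed.

Lemma Tword_insert (k : nat) (p q : 'I_k) s w lam (rs : seq 'I_k) :
  all (fun r => (r != p) && (r != q)) rs ->
  Tword (insert (pair_space p q) s w) lam rs = Tword s lam rs.
Proof.
elim: rs lam => //= r rs IH lam /andP[/andP[rp rq] pqrs].
by rewrite IH // !insert_out // pair_space_out.
Qed.

Section Relations.
Variables A B C D : 'rV[K]_n -> op K N 'I_2.
Hypothesis B_weight : conserves_on (pred1 s1) B.
Hypothesis C_weight : conserves_on (pred1 s2) C.
Hypothesis D_weight : forall lam, conserves [:: s1; s2] (D lam).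
Hypothesis Ct_unit : forall lam, ptr (pred1 s2) (C lam) \in unitmx.
Hypothesis Dt_unit : forall lam, ptr predT (D lam) \in unitmx.

(** On bivectors all structure matrices act from the left, as a b on one side and d c on the other,
    and [calR] is (d c)^-1 a b. Injectivity of [bivec] gives the way back. *)
Lemma exchange_relations_equiv :
  exchange_relations gamma mu A B C D T <->
  (forall lam, scal (calR gamma mu A B C D lam) *m Tprod lam [:: s1; s2]
               = Tprod lam [:: s2; s1]).
Proof.
suff E lam : scal (A lam) *m leg1 lam [::] s1 *m scal (B lam) *m leg1 lam [:: s1] s2 =
    leg1 lam [::] s2 *m scal (C lam) *m leg1 lam [:: s2] s1 *m scal (D lam) <->
    scal (calR gamma mu A B C D lam) *m Tprod lam [:: s1; s2] = Tprod lam [:: s2; s1].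
  by split=> H lam; apply/E/H.
pose a := leg2 A lam [::] (s1, false) (s2, false) : op K N ('I_2 * bool)%type.
pose b := leg2 (fun l => ptr (pred1 s1) (B l)) lam [::] (s1, true) (s2, false)
  : op K N ('I_2 * bool)%type.
pose c := leg2 (fun l => ptr (pred1 s2) (C l)) lam [::] (s1, false) (s2, true)
  : op K N ('I_2 * bool)%type.
pose d := leg2 (fun l => ptr predT (D l)) lam [::] (s1, true) (s2, true)
  : op K N ('I_2 * bool)%type.
have lhsE : bivec (scal (A lam) *m leg1 lam [::] s1 *m scal (B lam)
    *m leg1 lam [:: s1] s2) = scal (a *m b) *m Tprod lam [:: s1; s2].
  rewrite -!mulmxA bivec_scal_l mulmxA bivec_scal_mid //; last exact: B_weight.
  by rewrite scal_mul mulmxA.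
have rhsE : bivec (leg1 lam [::] s2 *m scal (C lam) *m leg1 lam [:: s2] s1
    *m scal (D lam)) = scal (d *m c) *m Tprod lam [:: s2; s1].
  rewrite bivec_scal_r bivec_scal_mid //; last exact: C_weight.
  by rewrite scal_mul mulmxA.
have cu : c \in unitmx by apply: leg2_unit.
have du : d \in unitmx by apply: leg2_unit.
have calRE : calR gamma mu A B C D lam = invmx (d *m c) *m (a *m b).
  by rewrite /calR !leg2_inv // invmx_mul // !mulmxA.
have dcu : d *m c \in unitmx by rewrite unitmx_mul du.
split=> [/(congr1 bivec)|E].
  rewrite lhsE rhsE => E; rewrite calRE scal_mul -mulmxA E mulmxA -scal_mul.
  by rewrite mulVmx // scal1 mul1mx.
apply: bivec_inj; rewrite lhsE rhsE -E calRE mulmxA -scal_mul.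
by rewrite mulKVmx.
Qed.

(** Of the primed spaces, C^t meets only 2' and B^t only 1', each in the factor whose weight it
    conserves, and A meets neither. D may exchange weight between 1' and 2', so only the sum is
    preserved. *)
Lemma calR_weight lam :
  conserves [:: (s1, true); (s2, true)] (calR gamma mu A B C D lam).
Proof.
have both X : conserves [:: (s1, true)] X -> conserves [:: (s2, true)] X ->
    conserves [:: (s1, true); (s2, true)] X := @conserves_cons _ _ _ X.
have Ci2 : conserves_on (pred1 s2) (fun l => invmx (ptr (pred1 s2) (C l))).
  by move=> i si l; apply/(conserves_inv (Ct_unit l))/conserves_ptr/(C_weight si).
have Bt1 : conserves_on (pred1 s1) (fun l => ptr (pred1 s1) (B l)).
  by move=> i si l; apply/conserves_ptr/(B_weight si).
have A0 : conserves_on pred0 A by [].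
have Di12 l : conserves [:: s1; s2] (invmx (ptr predT (D l))).
  exact/(conserves_inv (Dt_unit l))/conserves_predT/D_weight.
rewrite /calR; apply: conserves_mul; last by apply: both; exact: (conserves_leg2 Bt1).
apply: conserves_mul; last by apply: both; exact: (conserves_leg2 A0).
apply: conserves_mul; first by apply: both; exact: (conserves_leg2 Ci2).
exact: (@conserves_emb_map _ _ (fun i : 'I_2 => if i == s1 then (s1, true) else (s2, true))
  _ lam [::] [:: s1; s2] Di12).
Qed.

Hypothesis relT : exchange_relations gamma mu A B C D T.

(* The factors rs are untouched: calR preserves the total weight of the two
   primed spaces, hence the shift with which rs is evaluated. *)
Lemma Tword_exchange (k : nat) (p q : 'I_k) s lam (rs : seq 'I_k) :
  p != q -> all (fun r => (r != q) && (r != p)) rs ->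
  \sum_w entry (calR gamma mu A B C D lam) (restr (pair_space q p) s) w
    *: Tword (insert (pair_space q p) s w) lam [:: q, p & rs] =
  Tword s lam [:: p, q & rs].
Proof.
move=> pq pqrs; have qp : q != p by rewrite eq_sym.
have g_inj := pair_space_inj qp.
have g1 x : (q, x) = pair_space q p (s1, x) by [].
have g2 x : (p, x) = pair_space q p (s2, x) by [].
pose lam' := lam + gamma *: mu (s (p, true)) + gamma *: mu (s (q, true)).
transitivity (\sum_w (entry (calR gamma mu A B C D lam) (restr (pair_space q p) s) w
    *: Tword w lam [:: s1; s2]) * Tword s lam' rs).
  apply: eq_bigr => w _; rewrite -scalerAl.
  have [->|R0] := eqVneq (entry (calR gamma mu A B C D lam) (restr (pair_space q p) s) w) 0.
    by rewrite !scale0r.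
  congr (_ *: _); have := calR_weight R0.
  rewrite !big_cons !big_nil !addr0 !ffunE -g1 -g2 => muE.
  rewrite [LHS]/= Tword_insert // !g1 !g2 !insert_in // /= mulr1 mulrA.
  congr (_ * Tword s _ rs).
  by rewrite /lam' -!addrA -!scalerDr -muE [mu (s (q, _)) + _]addrC.
rewrite -mulr_suml.
transitivity (ventry (scal (calR gamma mu A B C D lam) *m Tprod lam [:: s1; s2])
    (restr (pair_space q p) s) * Tword s lam' rs).
  rewrite ventry_scal; congr (_ * _).
  by apply: eq_bigr => w _; rewrite ventry_Tprod.
rewrite (exchange_relations_equiv.1 relT) ventry_Tprod /= !ffunE -!g1 -!g2.
by rewrite mulr1 -mulrA.
Qed.

Lemma exchange_head (k : nat) (p q : 'I_k) lam (rs : seq 'I_k) :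
  p != q -> all (fun r => (r != q) && (r != p)) rs ->
  scal (calR_at gamma mu A B C D lam [::] q p) *m Tprod lam [:: q, p & rs] =
  Tprod lam [:: p, q & rs].
Proof.
move=> pq pqrs; have qp : q != p by rewrite eq_sym.
apply: tvecP => s; rewrite ventry_emb //; last exact: pair_space_inj.
rewrite ventry_Tprod -Tword_exchange // dyn_nil.
by apply: eq_bigr => w _; rewrite ventry_Tprod.
Qed.

Lemma exchange_next (k : nat) (p q r : 'I_k) lam (rs : seq 'I_k) :
  uniq [:: p; q; r] -> all (fun t => (t != r) && (t != q)) rs ->
  scal (calR_at gamma mu A B C D lam [:: (p, true)] r q)
    *m Tprod lam [:: p, r, q & rs] = Tprod lam [:: p, q, r & rs].
Proof.
rewrite /= !inE negb_or => /and3P[/andP[pq pr] qr _] qrs.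
have rq : r != q by rewrite eq_sym.
apply: tvecP => s; rewrite ventry_emb; last 2 first.
- exact: pair_space_inj.
- by move=> c; rewrite inE => /eqP->; apply: pair_space_out.
rewrite /Defs.dyn big_seq1 !ventry_Tprod.
(* Only the first letter is split off; the rest is a word starting with q, r at the shifted
   argument, to which the exchange at the head applies. *)
rewrite [RHS]/= -[RHS]/(_ * Tword s (lam + gamma *: mu (s (p, true))) [:: q, r & rs]).
rewrite -Tword_exchange // mulr_sumr; apply: eq_bigr => w _.
rewrite ventry_Tprod -scalerAr; congr (_ *: _).
rewrite [LHS]/= -[LHS]/(_ * Tword _ _ [:: r, q & rs]).
by rewrite !(insert_out _ _ (pair_space_out _ pr pq)).
Qed.

End Relations.

End Generators.


Lemma calR_atE A B C D k lam (P : seq ('I_k * bool)%type) (p q : 'I_k) :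
  (forall l, B l = flip (C l)) -> p != q ->
  all (fun c => (c.1 != p) && (c.1 != q)) P -> uniq P ->
  calR_at gamma mu A B C D lam P p q =
  leg2 (fun l => invmx (ptr (pred1 s2) (C l))) lam P (p, false) (q, true)
  *m leg2 (fun l => invmx (ptr predT (D l))) lam P (p, true) (q, true)
  *m leg2 A lam P (p, false) (q, false)
  *m leg2 (fun l => ptr (pred1 s2) (C l)) lam P (q, false) (p, true).
Proof.
move=> BC pq Ppq uP; have g_inj := pair_space_inj pq.
have Pout : {in P, forall c, c \notin codom (pair_space p q)}.
  by move=> [c x] /(allP Ppq)/andP[]; apply: pair_space_out.
have gl X i j : emb (pair_space p q) (fun l => leg2 X l [::] i j) lam P =
    leg2 X lam P (pair_space p q i) (pair_space p q j) by rewrite emb_leg2.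
rewrite /calR_at -/(pair_space p q) /calR !emb_mul // !gl; congr (_ *m _).
rewrite -[RHS]leg2_flip; apply: eq_emb => // l; rewrite BC ptr_flip; congr flip.
by apply: eq_ptr => -[[|[|//]] ?].
Qed.

End Dynamical.

Theorem theorem1 (R : realType) (n N : nat) (gamma : R[i])
  (mu : 'I_N -> 'rV[R[i]]_n) (A B C D : 'rV[R[i]]_n -> op R[i] N 'I_2)
  (* zero-weight conditions *)
  (hB : forall (h lam : 'rV[R[i]]_n), comm_mx (hact mu h s1) (B lam))
  (hC : forall (h lam : 'rV[R[i]]_n), comm_mx (hact mu h s2) (C lam))
  (hD : forall (h lam : 'rV[R[i]]_n),
      comm_mx (hact mu h s1 + hact mu h s2) (D lam))
  (* B_12 = C_21, A_21 = A_12^-1, D_21 = D_12^-1 *)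
  (hBC : forall lam, B lam = flip (C lam))
  (hA21 : forall lam, A lam \in unitmx /\ flip (A lam) = invmx (A lam))
  (hD21 : forall lam, D lam \in unitmx /\ flip (D lam) = invmx (D lam))
  (* the inverses entering the matrix calR exist *)
  (hCt : forall lam, ptr (pred1 s2) (C lam) \in unitmx)
  (hDt : forall lam, ptr predT (D lam) \in unitmx)
  (* dynamical Yang-Baxter equations on three spaces *)
  (hAAA : forall lam,
      let A_ := leg2 gamma mu A lam (L := 'I_3) in
      A_ [::] s1 s2 *m A_ [::] s1 s3 *m A_ [::] s2 s3
      = A_ [::] s2 s3 *m A_ [::] s1 s3 *m A_ [::] s1 s2)
  (hDDD : forall lam,
      let D_ := leg2 gamma mu D lam (L := 'I_3) in
      D_ [:: s3] s1 s2 *m D_ [::] s1 s3 *m D_ [:: s1] s2 s3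
      = D_ [::] s2 s3 *m D_ [:: s2] s1 s3 *m D_ [::] s1 s2)
  (hDBB : forall lam,
      let B_ := leg2 gamma mu B lam (L := 'I_3) in
      let D_ := leg2 gamma mu D lam (L := 'I_3) in
      D_ [::] s1 s2 *m B_ [::] s1 s3 *m B_ [:: s1] s2 s3
      = B_ [::] s2 s3 *m B_ [:: s2] s1 s3 *m D_ [::] s1 s2)
  (hACC : forall lam,
      let A_ := leg2 gamma mu A lam (L := 'I_3) in
      let C_ := leg2 gamma mu C lam (L := 'I_3) in
      A_ [::] s1 s2 *m C_ [::] s1 s3 *m C_ [::] s2 s3
      = C_ [::] s2 s3 *m C_ [::] s1 s3 *m A_ [:: s3] s1 s2) :
  [/\ relations_equiv gamma mu A B C D,
      rewriting_sound gamma mu A B C D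
    & three_space_consistent gamma mu A B C D].
Proof.
have B1 : conserves_on mu (pred1 s1) B.
  move=> i /eqP-> l; apply: conserves_hact => h; rewrite big_seq1; exact: hB.
have C2 : conserves_on mu (pred1 s2) C.
  move=> i /eqP-> l; apply: conserves_hact => h; rewrite big_seq1; exact: hC.
have D12 l : conserves mu [:: s1; s2] (D l).
  by apply: conserves_hact => h; rewrite big_cons big_seq1; exact: hD.
split.
- by move=> alg T; apply: exchange_relations_equiv.
- move=> alg T relT lam [M [[p q] r]]; rewrite /order_of => u /=.
  split; rewrite scal_mul -mulmxA; congr (_ *m _).
    apply: exchange_head => //.
      by move: u; rewrite /= !inE negb_or => /andP[/andP[]].
    by move: u; rewrite /= !inE negb_or ![r == _]eq_sym => /and3P[/andP[_ ->] -> _].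
  by apply: exchange_next.
move=> lam; rewrite /exchange_32_31_21 /exchange_21_31_32 /exch_left /exch_right /=.
congr pair; rewrite !mul1mx !calR_atE //.
apply: (exchange_mx_yang_baxter C2 hCt hDt hAAA hDDD _ hACC) => l /=.
(* B_{ab} = C_{ba} on any two legs and for any shift, which turns the D B B equation into D C C. *)
have BC (a b : 'I_3) P m : leg2 gamma mu C m P b a = leg2 gamma mu B m P a b.
  by rewrite -leg2_flip; apply: eq_emb => // k; rewrite hBC.
rewrite !BC; exact: hDBB.
Qed.
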